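(* Let $\sigma=\{\sigma_z\}_{z\in\mathbb{Z}}$ be i.i.d. strictly positive random variables with law $\mathbf{P}$, and suppose $L(x):=1/\mathbf{P}(\sigma_0>x)$ is slowly varying at infinity, i.e. $\lim_{u\to\infty}L(uv)/L(u)=1$ for every $v>0$. Let $\{X_s\}_{s\ge0}$ be the Bouchaud trap model in the landscape $\sigma$ started at $X_0=0$, with quenched law $P_\sigma$. Then for $i=1,2$, as $t\to\infty$, \[ P_\sigma\big(X_t=Z^{(i)}_t\big)+\frac{|Z^{(i)}_t|}{\sum_{z\in\Gamma_t}|z|}\to 1\quad\text{in }\mathbf{P}\text{-probability}.\]
   Context: The Bouchaud trap model (BTM) in the landscape $\sigma$ is the continuous-time Markov chain on $\mathbb{Z}$ with transition rates $w_{z\to y}=\frac{1}{2\sigma_z}$ if $|z-y|=1$ and $0$ otherwise; $P_\sigma$ denotes its law given $\sigma$ with $X_0=0$. Define $\ell_t:=\min\{s\ge0: sL(s)\ge t\}$, $Z^{(1)}_t:=\min\{z\in\mathbb{Z}^+:\sigma_z>\ell_t\}$, $Z^{(2)}_t:=\max\{z\in\mathbb{Z}^-:\sigma_z>\ell_t\}$ (with $\mathbb{Z}^+$ the positive and $\mathbb{Z}^-$ the non-positive integers), and $\Gamma_t:=\{Z^{(1)}_t,Z^{(2)}_t\}$. *)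

(* Defs.v *)
From HB Require Import structures.
From mathcomp Require Import all_boot all_order all_algebra.
From mathcomp Require Import all_classical all_reals all_analysis.
Set Implicit Arguments. Unset Strict Implicit. Unset Printing Implicit Defensive.
Import Order.TTheory GRing.Theory Num.Theory.
Import numFieldNormedType.Exports.
Local Open Scope classical_set_scope.
Local Open Scope ring_scope.

Definition iid_family (d : measure_display) (T : measurableType d) (R : realType)
  (P : probability T R) (X : int -> T -> R) : Prop :=
  (forall z, measurable_fun setT (X z)) /\
  (forall z (B : set R), measurable B -> P (X z @^-1` B) = P (X 0 @^-1` B)) /\
  (forall (s : seq int) (B : int -> set R), uniq s -> (forall z, measurable (B z)) ->
     P (\bigcap_(z in [set` s]) (X z @^-1` B z)) = (\prod_(z <- s) P (X z @^-1` B z))%E).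

Definition slowly_varying (R : realType) (L : R -> R) : Prop :=
  forall v : R, 0 < v -> (L (u * v) / L u) @[u --> +oo] --> (1 : R).

(* Minimal-chain (Feller) construction of the BTM transition probabilities:
   btm_step n sigma x y t = probability, starting from x, of being at y at time t
   having made exactly n jumps.  The holding time at x is exponential with rate
   1/sigma_x (= sum of the rates 1/(2 sigma_x) to x+1 and x-1) and each
   neighbour is chosen with probability 1/2. *)
Fixpoint btm_step (R : realType) (n : nat) (sigma : int -> R) (x y : int) (t : R)
  : \bar R :=
  match n with
  | 0%N => ((x == y)%:R * expR (- t / sigma x))%:E
  | n'.+1 =>
      (\int[@lebesgue_measure R]_(s in [set s : R | (0 <= s <= t)%R])
         (((sigma x)^-1 * expR (- s / sigma x) / 2)%R%:E *
          (btm_step n' sigma (x + 1)%R y (t - s)%R + btm_step n' sigma (x - 1)%R y (t - s)%R)))%E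
  end.

Definition btm_prob (R : realType) (sigma : int -> R) (t : R) (y : int) : R :=
  fine (\sum_(0 <= n <oo) btm_step n sigma 0 y t)%E.

Definition ell (R : realType) (L : R -> R) (t : R) : R :=
  inf [set s : R | 0 <= s /\ t <= s * L s].

(* Z^(1) := min { z >= 1 : sigma_z > l },  Z^(2) := max { z <= 0 : sigma_z > l }
   (default 0 on the null event where they do not exist). *)
Definition Z1 (R : realType) (sigma : int -> R) (l : R) : int :=
  xget 0 [set z : int | 0 < z /\ l < sigma z /\
                        (forall y : int, 0 < y -> y < z -> sigma y <= l)].
Definition Z2 (R : realType) (sigma : int -> R) (l : R) : int :=
  xget 0 [set z : int | z <= 0 /\ l < sigma z /\
                        (forall y : int, z < y -> y <= 0 -> sigma y <= l)].

(* Main.v *)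
(* The minimal kernel [p t x] (the probability to be at a fixed target [y] at time [t], starting
   from [x]) solves the backward equation [p' = (p (x + 1) + p (x - 1) - 2 p x) / (2 sigma x)].

   Staying: pairing [p] with a tent of half-width [m] around [y] against the reversible measure
   [sigma] gives a function of time with derivative at least [-1/m]; hence [p t y] stays close to
   [1] as long as [t] is small compared to [m * sigma y] and the other sites under the tent carry
   little mass.
   Hitting: by the maximum principle, [p t 0] is at least the harmonic function of the interval
   between the two traps, up to an error [exp (- t / (2 V))], where [V] bounds the expected exit
   time.  Together with [p_{Z1} + p_{Z2} <= 1] the two lower bounds determine both probabilities.

   Environment: let [l] be the level and [1 / q] the inverse tail of [sigma] at [l], so that
   [t] is of order [l / q].  With high probability the traps of depth above [l] nearest to the
   origin are at distance of order [1 / q], they are isolated on that scale, they are much deeper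
   than [l] (slow variation), and the remaining sites have total mass [o(l)] (Karamata). *)
Require Import Defs.
From HB Require Import structures.
From mathcomp Require Import all_boot all_order all_algebra.
From mathcomp Require Import all_classical all_reals all_analysis.
From mathcomp Require Import measurable_realfun.
From mathcomp Require Import ring lra zify.
Import Order.TTheory GRing.Theory Num.Theory.
Import numFieldNormedType.Exports.
Local Open Scope classical_set_scope.
Local Open Scope ring_scope.
Set Implicit Arguments. Unset Strict Implicit. Unset Printing Implicit Defensive.

(** * Minimal kernel: measurability and renewal equation *)

Lemma btm_step_ge0 (R : realType) (sigma : int -> R) (n : nat) (x y : int) (t : R) :
  (forall z, 0 < sigma z) -> (0 <= btm_step n sigma x y t)%E.
Proof.
move=> s0; elim: n x t => [|n IH] x t /=.
  by rewrite lee_fin mulr_ge0 // expR_ge0.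
apply: integral_ge0 => s _; apply: mule_ge0; last exact: adde_ge0.
by rewrite lee_fin !mulr_ge0 ?expR_ge0 ?invr_ge0 // ltW.
Qed.

Lemma measurable_set_cc (R : realType) (t : R) :
  measurable [set s : R | (0 <= s <= t)%R].
Proof.
by rewrite (_ : [set s | _] = `[0, t]%classic).
Qed.

(** Positivity lets the inverse be written as [expR (- ln _)], a composition of measurable maps. *)
Lemma measurable_inv_pos (d : measure_display) (T : measurableType d) (R : realType)
  (f : T -> R) : (forall x, 0 < f x) -> measurable_fun setT f ->
  measurable_fun setT (fun x => (f x)^-1).
Proof.
move=> f0 mf.
rewrite (_ : (fun x => _) = (fun x => expR (- ln (f x)))).
  apply: measurableT_comp => //; apply: measurableT_comp => //.
  exact: measurableT_comp.
by apply/funext => x; rewrite expRN lnK ?posrE.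
Qed.

(** The induction carries joint measurability in the environment and the time: each jump integrates
    the previous kernel at time [t - s], and Tonelli makes the integral a measurable function of the
    pair. *)
Lemma measurable_btm_step (d : measure_display) (T : measurableType d) (R : realType)
  (X : int -> T -> R) (n : nat) (x y : int) :
  (forall z, measurable_fun setT (X z)) -> (forall z w, 0 < X z w) ->
  measurable_fun setT (fun wt : T * R => btm_step n (fun z => X z wt.1) x y wt.2).
Proof.
move=> mX X0; elim: n x => [|n IH] x /=.
  apply/measurable_EFinP; apply: measurable_funM => //.
  apply: measurableT_comp => //; apply: measurable_funM.
    by apply: measurableT_comp => //.
  by apply: measurable_inv_pos => //; apply: measurableT_comp.
(* Extending the integrand by zero off [0 <= s <= t] frees the domain of integration from the
   parameter. *)
pose G (p : (T * R) * R) : \bar R :=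
  (((0 <= p.2 <= p.1.2)%R%:R%:E) * ((((X x p.1.1)^-1 * expR (- p.2 / X x p.1.1) / 2)%R%:E *
          (btm_step n (fun z => X z p.1.1) (x + 1)%R y (p.1.2 - p.2)%R +
           btm_step n (fun z => X z p.1.1) (x - 1)%R y (p.1.2 - p.2)%R))))%E.
have mX1 : measurable_fun setT (fun p : (T * R) * R => (X x p.1.1)^-1).
  apply: measurable_inv_pos => //; apply: measurableT_comp => //.
  exact: measurableT_comp.
have mG : measurable_fun setT G.
  apply: emeasurable_funM.
    apply/measurable_EFinP.
    apply: (@measurableT_comp _ _ _ _ _ _ (fun b : bool => b%:R : R)) => //.
    apply: measurable_and.
      by apply: measurable_fun_ler.
    apply: measurable_fun_ler => //.
    exact: measurableT_comp.
  apply: emeasurable_funM.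
    apply/measurable_EFinP; apply: measurable_funM => //; apply: measurable_funM => //.
    apply: measurableT_comp => //; apply: measurable_funM => //.
    exact: measurableT_comp.
  have mp : measurable_fun setT (fun p : (T * R) * R => (p.1.1, p.1.2 - p.2)).
    apply: measurable_fun_pair.
      by apply: measurableT_comp.
    by apply: measurable_funB => //; apply: measurableT_comp.
  apply: emeasurable_funD.
    exact: (measurableT_comp (IH (x + 1)) mp).
  exact: (measurableT_comp (IH (x - 1)) mp).
have G0 p : (0 <= G p)%E.
  apply: mule_ge0; first by rewrite lee_fin.
  apply: mule_ge0; last by apply: adde_ge0; apply: btm_step_ge0.
  by rewrite lee_fin !mulr_ge0 ?expR_ge0 ?invr_ge0 // ltW.
have := @measurable_fun_fubini_tonelli_F _ _ (T * R)%type (measurableTypeR R) R (@lebesgue_measure R) G mG G0.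
apply: eq_measurable_fun => -[w t] _ /=.
rewrite /fubini_F [in RHS]integral_mkcond; apply: eq_integral => s _.
rewrite /G patchE /=.
have -> : (s \in [set s : R | 0 <= s <= t]) = (0 <= s <= t).
  by apply/idP/idP; rewrite inE.
by case: ifP => _; rewrite ?mul1e ?mul0e.
Qed.

Lemma measurable_btm_prob (d : measure_display) (T : measurableType d) (R : realType)
  (X : int -> T -> R) (t : R) (y : int) :
  (forall z, measurable_fun setT (X z)) -> (forall z w, 0 < X z w) ->
  measurable_fun setT (fun w => btm_prob (fun z => X z w) t y).
Proof.
move=> mX X0; rewrite /btm_prob.
apply: measurableT_comp => //.
apply: ge0_emeasurable_sum.
  by move=> k w _ _; apply: btm_step_ge0.
move=> k _.
exact: (measurableT_comp (measurable_btm_step k 0 y mX X0)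
  (measurable_fun_pair (f := fun w : T => w) (g := fun _ => t) (@measurable_id _ _ setT) (measurable_cst t))).
Qed.

(** The reflection [t - s] preserves the length of half-open intervals, and these determine Lebesgue
    measure. *)
Lemma integral_flip (R : realType) (t : R) (f : R -> \bar R) :
  measurable_fun setT f -> (forall s, 0 <= f s)%E ->
  (\int[@lebesgue_measure R]_(s in [set s : R | (0 <= s <= t)%R]) f (t - s)%R =
   \int[@lebesgue_measure R]_(s in [set s : R | (0 <= s <= t)%R]) f s)%E.
Proof.
move=> mf f0.
pose phi : measurableTypeR R -> measurableTypeR R := fun s => t - s.
have mphi : measurable_fun setT phi by apply: measurable_funB.
have E (A : set (measurableTypeR R)) : measurable A ->
    lebesgue_measure A = pushforward (@lebesgue_measure R) phi A.
  move=> mA.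
  pose m := measure_function_pushforward__canonical__measure_function_Measure lebesgue_measure mphi.
  apply: (@lebesgue_measure_unique R m) => //.
  move=> _ [[a b] /= _ <-].
  rewrite /m /= /pushforward.
  have -> : phi @^-1` `]a, b] = `[t - b, t - a[%classic.
    by apply/seteqP; split => s /=; rewrite /phi !in_itv /=; lra.
  rewrite !lebesgue_measure_itv /= !lte_fin ltrD2l ltrN2.
  by case: ifP => // _; rewrite -!EFinD; congr EFin; lra.
have mD := measurable_set_cc t.
transitivity (\int[pushforward (@lebesgue_measure R) phi]_(s in [set s : R | (0 <= s <= t)%R]) f s)%E.
  rewrite ge0_integral_pushforward //; last by apply: measurable_funTS.
  rewrite (_ : phi @^-1` [set s | 0 <= s <= t] = [set s : R | (0 <= s <= t)%R]) //.
  by apply/seteqP; split => s /=; rewrite /phi; lra.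
by apply/esym; apply: eq_measure_integral => A mA _; exact: E.
Qed.

(** The first-jump operator: [btm_step n.+1] is its value at [btm_step n]. It acts on arbitrary
    functions so that sums of kernels can be inserted. *)
Definition jump_int (R : realType) (sigma : int -> R) (x : int) (t : R)
  (f : int -> R -> \bar R) : \bar R :=
  (\int[@lebesgue_measure R]_(s in [set s : R | (0 <= s <= t)%R])
     (((sigma x)^-1 * expR (- s / sigma x) / 2)%R%:E *
      (f (x + 1)%R (t - s)%R + f (x - 1)%R (t - s)%R)))%E.

Section jump_integral.
Variables (R : realType) (sigma : int -> R).
Hypothesis sigma0 : forall z, 0 < sigma z.

Lemma btm_step_meas (n : nat) (x y : int) :
  measurable_fun setT (fun t : R => btm_step n sigma x y t).
Proof.
have := @measurable_btm_step _ R R (fun z _ => sigma z) n x y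
  (fun z => measurable_cst _) (fun z _ => sigma0 z).
move=> H; exact: (measurableT_comp H
  (measurable_fun_pair (f := fun w : R => w) (g := fun w : R => w) (@measurable_id _ _ setT) (@measurable_id _ _ setT))).
Qed.

Let k (x : int) (s : R) : \bar R := ((sigma x)^-1 * expR (- s / sigma x) / 2)%R%:E.

Lemma jump_kernel_ge0 x s : (0 <= ((sigma x)^-1 * expR (- s / sigma x) / 2)%R%:E)%E.
Proof. by rewrite lee_fin !mulr_ge0 ?expR_ge0 ?invr_ge0 // ltW. Qed.

Lemma jump_kernel_meas x : measurable_fun setT (k x).
Proof.
apply/measurable_EFinP; apply: measurable_funM => //; apply: measurable_funM => //.
apply: measurableT_comp => //; apply: measurable_funM => //.
Qed.

Lemma measurable_reverse (f : R -> \bar R) (t : R) : measurable_fun setT f ->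
  measurable_fun setT (fun s : R => f (t - s)%R).
Proof. by move=> mf; apply: (measurableT_comp mf); apply: measurable_funB. Qed.

Lemma jump_integrand_meas x t (f : int -> R -> \bar R) :
  (forall z, measurable_fun setT (f z)) ->
  measurable_fun setT (fun s : R => (k x s * (f (x + 1)%R (t - s)%R + f (x - 1)%R (t - s)%R))%E).
Proof.
move=> mf; apply: emeasurable_funM; first exact: jump_kernel_meas.
by apply: emeasurable_funD; exact: measurable_reverse.
Qed.

Lemma le_jump_int x t (f g : int -> R -> \bar R) :
  (forall z, measurable_fun setT (f z)) -> (forall z, measurable_fun setT (g z)) ->
  (forall z s, 0 <= f z s)%E -> (forall z s, (0 <= s)%R -> f z s <= g z s)%E ->
  (jump_int sigma x t f <= jump_int sigma x t g)%E.
Proof.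
move=> mf mg f0 fg; apply: ge0_le_integral.
- exact: measurable_set_cc.
- by move=> s _; apply: mule_ge0; [exact: jump_kernel_ge0|exact: adde_ge0].
- by apply: measurable_funTS; exact: jump_integrand_meas.
- by apply: measurable_funTS; exact: jump_integrand_meas.
- move=> s /= /andP[s0 st]; apply: lee_wpmul2l; first exact: jump_kernel_ge0.
  by apply: leeD; apply: fg; rewrite subr_ge0.
Qed.

Lemma jump_intD x t (f g : int -> R -> \bar R) :
  (forall z, measurable_fun setT (f z)) -> (forall z, measurable_fun setT (g z)) ->
  (forall z s, 0 <= f z s)%E -> (forall z s, 0 <= g z s)%E ->
  (jump_int sigma x t (fun z s => f z s + g z s) = jump_int sigma x t f + jump_int sigma x t g)%E.
Proof.
move=> mf mg f0 g0; rewrite /jump_int -ge0_integralD.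
- apply: eq_integral => s _; rewrite -ge0_muleDr; last 2 first.
    exact: adde_ge0. exact: adde_ge0.
  by congr (_ * _)%E; rewrite addeACA.
- exact: measurable_set_cc.
- by move=> s _; apply: mule_ge0; [exact: jump_kernel_ge0|exact: adde_ge0].
- by apply: measurable_funTS; exact: jump_integrand_meas.
- by move=> s _; apply: mule_ge0; [exact: jump_kernel_ge0|exact: adde_ge0].
- by apply: measurable_funTS; exact: jump_integrand_meas.
Qed.

(** With both neighbours worth one, the operator returns the distribution function of the
    exponential holding time. *)
Lemma jump_int_cst (x : int) (t : R) : 0 <= t ->
  jump_int sigma x t (fun _ _ => 1%E) = (1 - expR (- t / sigma x))%:E.
Proof.
rewrite le_eqVlt => /predU1P[<-|t0].
  rewrite /jump_int oppr0 mul0r expR0 subrr.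
  rewrite (_ : [set s : R | _] = [set 0]) ?integral_set1 //.
  by apply/seteqP; split => s /=; [move=> h; apply/eqP; rewrite eq_le andbC|move=> ->; rewrite lexx].
have dF (s : R) : is_derive s 1 (fun s => - expR (- s / sigma x)) ((sigma x)^-1 * expR (- s / sigma x)).
  apply: is_derive_eq; rewrite scaler0 add0r /GRing.scale /=; ring.
have cE : continuous (fun s : R => expR (- s / sigma x)).
  by move=> s; apply/differentiable_continuous/derivable1_diffP; exact: ex_derive.
have cf : continuous (fun s : R => (sigma x)^-1 * expR (- s / sigma x)).
  by move=> s; apply: cvgM; [exact: cvg_cst|exact: cE].
have -> : jump_int sigma x t (fun _ _ => 1%E) =
    (\int[@lebesgue_measure R]_(s in `[0%R, t]) ((sigma x)^-1 * expR (- s / sigma x))%R%:E)%E.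
  apply: eq_integral => s _; rewrite -[1%E]/(1%:E) -EFinD -EFinM; congr EFin; field.
  by rewrite gt_eqF.
rewrite (@continuous_FTC2 R _ (fun s => - expR (- s / sigma x))) //.
- by rewrite -EFinB oppr0 mul0r expR0; congr EFin; ring.
- exact: continuous_subspaceT.
- have cF : continuous (fun s : R => - expR (- s / sigma x)).
    by move=> s; apply: cvgN; exact: cE.
  split.
  + by move=> s _; have [] := dF s.
  + by apply: cvg_at_right_filter; exact: cF.
  + by apply: cvg_at_left_filter; exact: cF.
- by move=> s _; rewrite derive1E; have [_ ->] := dF s.
Qed.

Section renewal.
Variable g : nat -> int -> R -> \bar R.
Hypothesis g0 : forall n z s, (0 <= g n z s)%E.
Hypothesis mg : forall n z, measurable_fun setT (g n z).
Hypothesis gS : forall n z s, g n.+1 z s = jump_int sigma z s (g n).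

(** [g] stays abstract because it stands both for the kernel of one target and for the sum of the
    kernels of two targets. *)
Lemma renewal_partial N x t :
  (\sum_(0 <= n < N.+1) g n x t =
   g 0%N x t + jump_int sigma x t (fun z s => \sum_(0 <= n < N) g n z s))%E.
Proof.
elim: N => [|N IH].
  rewrite big_nat1 (_ : jump_int _ _ _ _ = 0%E) ?adde0 //.
  rewrite /jump_int; apply: integral0_eq => s _.
  by rewrite !big_nil adde0 mule0.
rewrite big_nat_recr //= IH gS -addeA; congr (_ + _)%E.
rewrite -jump_intD //.
- by apply: eq_integral => s _; rewrite !big_nat_recr.
- by move=> z; apply: emeasurable_sum.
- by move=> z s; apply: sume_ge0.
Qed.

(** All terms are nonnegative, so the sum over the number of jumps passes under the integral by
    monotone convergence. *)
Lemma renewal_series x t :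
  (\sum_(0 <= n <oo) g n x t =
   g 0%N x t + jump_int sigma x t (fun z s => \sum_(0 <= n <oo) g n z s))%E.
Proof.
rewrite nneseries_recl //; congr (_ + _)%E.
rewrite -(nneseries_addn (f := fun n => g n x t) 1) //.
transitivity (\sum_(0 <= n <oo) jump_int sigma x t (g n))%E.
  by apply: eq_eseriesr => n _; rewrite addn1 gS.
rewrite /jump_int -integral_nneseries.
- apply: eq_integral => s _.
  rewrite nneseriesZl; last by move=> n _; exact: adde_ge0.
  by rewrite nneseriesD.
- exact: measurable_set_cc.
- by move=> n; apply: measurable_funTS; exact: jump_integrand_meas.
- by move=> n s _; apply: mule_ge0; [exact: jump_kernel_ge0|exact: adde_ge0].
Qed.

(** Induction on the number of jumps: the jump-free term is at most the probability of no jump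
    before [t], and by the induction hypothesis the rest is at most the probability of a jump. The
    two add up to one. *)
Lemma renewal_le1 x t :
  (forall z s, (0 <= s)%R -> g 0%N z s <= (expR (- s / sigma z))%R%:E)%E -> 0 <= t ->
  (\sum_(0 <= n <oo) g n x t <= 1)%E.
Proof.
move=> g1 t0.
suff H N : forall x t, 0 <= t -> (\sum_(0 <= n < N) g n x t <= 1)%E.
  apply: lime_le; first by apply: is_cvg_nneseries => n _ _.
  by apply: nearW => N; exact: H.
elim: N => [|N IH] {}x {}t {}t0; first by rewrite big_nil lee01.
rewrite renewal_partial.
apply: (@le_trans _ _ ((expR (- t / sigma x))%:E + (1 - expR (- t / sigma x))%:E)%E).
  apply: leeD; first exact: g1.
  rewrite -jump_int_cst //; apply: le_jump_int => //.
  - by move=> z; apply: emeasurable_sum.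
  - by move=> z s; apply: sume_ge0.
by rewrite addeC -EFinD subrK.
Qed.

End renewal.
End jump_integral.

(** * Lower bounds for solutions of the backward equation *)

(** Continuity up to time [0] is a separate clause: a two-sided derivative at [0] would involve
    negative times. *)
Definition heat_sol (R : realType) (sigma : int -> R) (u : R -> int -> R) : Prop :=
  [/\ forall (s : R) x, 0 <= s -> 0 <= u s x <= 1,
      forall (T : R) x, 0 <= T -> {within `[0, T], continuous (fun s => u s x)} &
      forall (s : R) x, 0 < s -> is_derive s 1 (fun s => u s x)
        ((u s (x + 1) + u s (x - 1) - 2 * u s x) / (2 * sigma x))].

(** Yields the contradiction in the maximum principle: a minimum over [[0, T]] cannot sit at a
    positive time with positive derivative. *)
Lemma derive_pos_left (R : realType) (f : R -> R) (s d : R) :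
  0 < s -> 0 < d -> is_derive s 1 f d -> exists2 r, 0 <= r < s & f r < f s.
Proof.
move=> s0 d0 [df fd].
have : (h^-1 *: ((f \o shift s) (h *: 1) - f s)) @[h --> 0^'] --> d.
  by rewrite -fd; exact: df.
move=> /cvgr_gt /(_ 0 d0); rewrite near_withinE => -[e /= e0 He].
(* [e / 2] keeps the increment inside the neighbourhood, and [s] keeps the earlier time
   nonnegative. *)
pose h := Num.min (e / 2) s.
have h0 : 0 < h by rewrite lt_min s0 divr_gt0.
have hs : h <= s by rewrite ge_min lexx orbT.
have he : h < e by rewrite gt_min; apply/orP; left; rewrite ltr_pdivrMr // ltr_pMr // ltr1n.
have := He (- h); rewrite /ball_ /= sub0r opprK gtr0_norm // => /(_ he).
rewrite oppr_eq0 gt_eqF // => /(_ isT).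
rewrite /GRing.scale /= mulr1 invrN mulNr oppr_gt0 pmulr_rlt0 ?invr_gt0 // subr_lt0 => H.
by exists (- h + s) => //; apply/andP; split; lra.
Qed.

Lemma within_continuous_sum (R : realType) (A : set R) (m : nat) (f : nat -> R -> R) :
  (forall k, {within A, continuous (f k)}) ->
  {within A, continuous (fun s => \sum_(k < m) f k s)}.
Proof.
move=> cf; elim: m => [|m IH].
  rewrite (_ : (fun _ => _) = cst 0); last by apply/funext => s; rewrite big_ord0.
  by move=> x; exact: cvg_cst.
rewrite (_ : (fun _ => _) = ((fun s => \sum_(k < m) f k s) + f m)); last first.
  by apply/funext => s; rewrite big_ord_recr.
by move=> x; apply: continuousD; [exact: IH|exact: cf].
Qed.

(** Double summation by parts against the weights of a tent. [D] is the second difference of the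
    even extension of [v], halved at the centre because the tent is folded there. *)
Lemma tent_sum (R : realType) (v D : nat -> R) (m : nat) :
  D 0%N = v 1%N - v 0%N ->
  (forall k, D k.+1 = v k.+2 + v k - 2 * v k.+1) ->
  \sum_(k < m) (m%:R - k%:R) * D k = v m - v 0%N.
Proof.
move=> D0 DS.
have tel j : \sum_(k < j.+1) D k = v j.+1 - v j.
  elim: j => [|j IH]; first by rewrite big_ord1.
  by rewrite big_ord_recr /= IH DS; ring.
elim: m => [|m IH]; first by rewrite big_ord0 subrr.
transitivity (\sum_(k < m.+1) (m%:R - k%:R) * D k + \sum_(k < m.+1) D k).
  by rewrite -big_split; apply: eq_bigr => k _; rewrite -natr1 /=; ring.
by rewrite tel big_ord_recr /= IH; ring.
Qed.

(* The functional [m * sigma b * u s b + ...] below is the mass of the tent of half-width [m]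
   centred at [b] against the reversible measure [sigma]: summing by parts, only the kink at [b]
   can make it decrease. *)
Lemma stay_near (R : realType) (sigma : int -> R) (u : R -> int -> R) (b : int)
  (m : nat) (s : R) :
  (forall z, 0 < sigma z) -> heat_sol sigma u -> u 0 b = 1 -> (0 < m)%N -> 0 <= s ->
  1 - (s / m%:R + \sum_(1 <= k < m) (sigma (b + k%:Z) + sigma (b - k%:Z))) / sigma b <= u s b.
Proof.
move=> sigma0 [u01 uc ud] ub m0 s0.
(* The two sites at distance [k] from [b] are folded together. [D s k] is the time derivative of
   [G k] and also the second difference of the averages [v s]. *)
pose G (k : nat) (s : R) := if k is k'.+1 then
  sigma (b + k%:Z) * u s (b + k%:Z) + sigma (b - k%:Z) * u s (b - k%:Z) else sigma b * u s b.
pose lap (s : R) (x : int) := u s (x + 1) + u s (x - 1) - 2 * u s x.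
pose D (s : R) (k : nat) := if k is k'.+1 then
  (lap s (b + k%:Z) + lap s (b - k%:Z)) / 2 else lap s b / 2.
pose v (s : R) (k : nat) := (u s (b + k%:Z) + u s (b - k%:Z)) / 2.
have dG k (r : R) : 0 < r -> is_derive r 1 (G k) (D r k).
  move=> r0; case: k => [|k] /=.
    have := ud r b r0 => dub; apply: is_derive_eq.
    by rewrite /GRing.scale /= /lap; field; rewrite gt_eqF.
  have := ud r (b + k.+1%:Z) r0 => d1; have := ud r (b - k.+1%:Z) r0 => d2.
  apply: is_derive_eq.
  by rewrite /GRing.scale /= /lap; field; rewrite !gt_eqF.
pose F (r : R) := \sum_(k < m) (m%:R - k%:R) * G k r.
have dF (r : R) : 0 < r -> is_derive r 1 F (v r m - v r 0%N).
  move=> r0; rewrite -(@tent_sum _ (v r) (D r) m); last 2 first.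
  - by rewrite /D /v /lap [b + 0%:Z]addr0 ?[b - 0%:Z]subr0; field.
  - move=> k; rewrite /D /v /lap.
    have -> : b + k.+1%:Z + 1 = b + k.+2%:Z by lia.
    have -> : b + k.+1%:Z - 1 = b + k%:Z by lia.
    have -> : b - k.+1%:Z + 1 = b - k%:Z by lia.
    have -> : b - k.+1%:Z - 1 = b - k.+2%:Z by lia.
    by field.
  rewrite (_ : F = \sum_(k < m) (fun r => (m%:R - k%:R) * G k r)); last first.
    by apply/funext => x; rewrite fct_sumE.
  apply: is_derive_sum => i.
  have := dG i r r0 => dGi.
  by apply: is_derive_eq; rewrite /GRing.scale /=; ring.
have cF : {within `[0, s], continuous F}.
  apply: (@within_continuous_sum _ _ m (fun k r => (m%:R - k%:R) * G k r)) => k x.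
  apply: cvgM; first exact: cvg_cst.
  case: k => [|k] /=; last apply: cvgD; apply: cvgM;
    first [exact: cvg_cst | exact: (uc s _ s0 x)].
(* The derivative of [F] is at least [-1], since averages of [u] lie between [0] and [1]. So [F]
   loses at most [s] by time [s]. *)
have [c c0s] : exists2 c, c \in `[0, s] & F s - F 0 = (v c m - v c 0%N) * (s - 0).
  apply: (@MVT_segment _ F (fun c => v c m - v c 0%N)) => // x.
  by rewrite in_itv /= => /andP[x0 _]; exact: dF.
rewrite subr0 => Fs.
have c0 : 0 <= c by move: c0s; rewrite in_itv /= => /andP[].
have vc : -1 <= v c m - v c 0%N.
  rewrite /v [b + 0%:Z]addr0 ?[b - 0%:Z]subr0.
  have /andP[? ?] := u01 c (b + m%:Z) c0; have /andP[? ?] := u01 c (b - m%:Z) c0.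
  have /andP[? ?] := u01 c b c0.
  lra.
have G0 k (r : R) : 0 <= r -> 0 <= G k r.
  move=> r0; have up x : 0 <= sigma x * u r x.
    by rewrite mulr_ge0 ?(ltW (sigma0 _)) //; have /andP[] := u01 r x r0.
  by case: k => [|k] /=; rewrite ?addr_ge0.
have F0 : m%:R * sigma b <= F 0.
  rewrite /F -(prednK m0) big_ord_recl /= subr0 ub mulr1 lerDl.
  apply: sumr_ge0 => i _; apply: mulr_ge0; last exact: (G0 (bump 0 i) 0 (lexx 0)).
  by rewrite subr_ge0 ler_nat /bump /= add1n ltnW // ltnS.
pose S := \sum_(1 <= k < m) (sigma (b + k%:Z) + sigma (b - k%:Z)).
(* Away from the centre, [u] is bounded by [1] and the tent by its height [m]. *)
have Fle : F s <= m%:R * (sigma b * u s b + S).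
  rewrite /F /S -(big_mkord xpredT (fun k => (m%:R - k%:R) * G k s)) big_ltn //.
  rewrite subr0 mulrDr lerD2l mulr_sumr big_nat_cond [leRHS]big_nat_cond.
  apply: ler_sum => -[|k] // /andP[/andP[_ km] _].
  apply: ler_pM => //; first by rewrite subr_ge0 ler_nat ltnW.
  - exact: G0.
  - by rewrite gerDl oppr_le0.
  have up x : sigma x * u s x <= sigma x.
    by rewrite ger_pMr //; have /andP[] := u01 s x s0.
  exact: lerD.
have m0' : 0 < m%:R :> R by rewrite ltr0n.
rewrite -(ler_pM2r (sigma0 b)) mulrBl mul1r divfK ?gt_eqF // -/S.
have : - s <= F s - F 0 by rewrite Fs; nra.
set q := s / m%:R; have sq : s = q * m%:R by rewrite mulfVK ?gt_eqF.
move=> H; have : 0 <= m%:R * (sigma b * u s b + S + q - sigma b) by lra.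
by rewrite pmulr_rge0 //; lra.
Qed.

(** At a negative space-time minimum of [D + eps * s] the site is interior and the time positive.
    The second difference is then nonnegative, the time derivative at least [eps], and a smaller
    value occurs just before. *)
Lemma max_principle (R : realType) (n : nat) (r : nat -> R) (D dD : R -> nat -> R) (T : R) :
  0 <= T -> (forall i, 0 <= r i) ->
  (forall i, (i <= n)%N -> {within `[0, T], continuous (fun s => D s i)}) ->
  (forall i (s : R), (0 < i < n)%N -> 0 < s <= T -> is_derive s 1 (fun s => D s i) (dD s i)) ->
  (forall i (s : R), (0 < i < n)%N -> 0 < s <= T ->
     r i * (D s i.+1 + D s i.-1 - 2 * D s i) <= dD s i) ->
  (forall i, (i <= n)%N -> 0 <= D 0 i) ->
  (forall s : R, 0 <= s <= T -> 0 <= D s 0%N /\ 0 <= D s n) ->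
  forall i, (i <= n)%N -> 0 <= D T i.
Proof.
move=> T0 r0 cD dDE dDle D0 Dbd i0 i0n; rewrite leNgt; apply/negP => DT.
(* Small enough for the tilted function to remain negative at time [T] and site [i0]. *)
pose eps := - D T i0 / (2 * (T + 1)).
have eps0 : 0 < eps by rewrite divr_gt0 ?oppr_gt0 // mulr_gt0 // ltr_wpDl.
pose E (s : R) (i : nat) := D s i + eps * s.
have ET : E T i0 < 0.
  rewrite /E; suff : eps * T <= - D T i0 / 2 by lra.
  rewrite /eps invfM mulrA -mulrA ger_pMr; last by rewrite divr_gt0 ?oppr_gt0.
  by rewrite mulrC ler_pdivrMr ?mul1r ?lerDl // ltr_wpDl.
have cE i : (i <= n)%N -> {within `[0, T], continuous (fun s => E s i)}.
  move=> ile x; apply: cvgD; first exact: cD.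
  apply: cvgM; first exact: cvg_cst.
  by move: x; apply: continuous_subspaceT => y; exact: cvg_id.
(* The space-time minimum is taken first in time at each site, by compactness, and then over the
   finitely many sites. *)
have /choice[c cP] : forall i : 'I_n.+1, exists c, c \in `[0, T] /\
    forall t, t \in `[0, T] -> E c i <= E t i.
  move=> i; have [c c1 c2] := EVT_min T0 (cE i (ltn_ord i)).
  by exists c.
pose j0 : 'I_n.+1 := inord i0.
have [i1 _ i1min] : exists2 i, true & forall j : 'I_n.+1, E (c i) i <= E (c j) j.
  case: (@Order.TotalTheory.arg_minP _ _ _ j0 xpredT (fun i => E (c i) i) isT) => i _ Hi.
  by exists i => // j; exact: Hi.
have [c1T _] := cP i1; move: (c1T); rewrite in_itv /= => /andP[c10 c1le].
have all j : (j <= n)%N -> E (c i1) i1 <= E (c i1) j.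
  move=> jn; have := i1min (inord j) => /le_trans; apply.
  have [_ /(_ _ c1T)] := cP (inord j).
  by rewrite !inordK.
have neg : E (c i1) i1 < 0.
  apply: le_lt_trans ET; apply: (le_trans (i1min j0)).
  have [_] := cP j0; rewrite /j0 inordK //; apply.
  by rewrite in_itv /= T0 lexx.
have negD : D (c i1) i1 < 0.
  by apply: le_lt_trans neg; rewrite /E lerDl mulr_ge0 // ltW.
have i1n : (i1 <= n)%N by rewrite -ltnS.
have c1pos : 0 < c i1.
  rewrite lt_neqAle c10 andbT eq_sym; apply: contraTneq negD => ->.
  by rewrite -leNgt D0.
have [b0 bn] := Dbd (c i1) (introT andP (conj c10 c1le)).
have i1int : (0 < i1 < n)%N.
  apply/andP; split.
    by rewrite lt0n; apply: contraTneq negD => ->; rewrite -leNgt.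
  by rewrite ltn_neqAle i1n andbT; apply: contraTneq negD => ->; rewrite -leNgt.
have c1in : 0 < c i1 <= T by rewrite c1pos.
have dpos : 0 <= dD (c i1) i1.
  apply: le_trans (dDle _ _ i1int c1in); apply: mulr_ge0 => //.
  have := all i1.+1; have := all i1.-1; rewrite /E !lerD2r.
  have /andP[i1a i1b] := i1int.
  move=> /(_ (leq_trans (leq_pred _) i1n)) ? /(_ i1b) ?; lra.
have dE : is_derive (c i1) 1 (fun s => E s i1) (dD (c i1) i1 + eps).
  have := dDE _ _ i1int c1in => ?.
  by apply: is_derive_eq; rewrite /GRing.scale /=; ring.
have [q /andP[q0 qc]] := derive_pos_left c1pos (ltr_wpDl dpos eps0) dE.
have [_ /(_ q)] := cP i1; rewrite in_itv /= q0 (ltW (lt_le_trans qc c1le)) => /(_ isT).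
by rewrite leNgt => /negP.
Qed.

(** The distance to [j] is, up to a factor, the Green function of the second difference on the line.
    This allows a function with prescribed second differences to be built as a superposition. *)
Lemma second_diff_dist (R : realType) (i j : nat) : (0 < i)%N ->
  `|i.+1%:R - j%:R| + `|i.-1%:R - j%:R| - 2 * `|i%:R - j%:R| = (2 *+ (i == j) : R).
Proof.
case: i => // i _ /=; rewrite -natr1 -natr1.
have [<-|ij] := eqVneq.
  rewrite -natr1 [X in `|X| + _](_ : _ = 1); last by ring.
  rewrite [X in _ + `|X| - _](_ : _ = - 1); last by ring.
  by rewrite subrr normr0 normrN normr1 (mulr1n 2); ring.
rewrite mulr0n; have [lt|] := ltnP i.+1 j.
  have H : i%:R + 1 + 1 <= j%:R :> R by rewrite !natr1 ler_nat.
  rewrite !ler0_norm; lra.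
rewrite leq_eqVlt eq_sym (negbTE ij) /= ltnS => ji.
have H : j%:R <= i%:R :> R by rewrite ler_nat.
rewrite !ger0_norm; lra.
Qed.

(* [exp (- s / (2 V)) (1 + v i / V)], with [v] a bound on the expected exit time from the interval,
   is a supersolution that dominates every initial condition bounded by [1]. *)
Lemma hitting_lower_bound (R : realType) (sigma : int -> R) (u : R -> int -> R) (lo : int)
  (n : nat) (T V alpha beta : R) (i : nat) :
  (forall z, 0 < sigma z) -> heat_sol sigma u -> 0 <= T -> 0 < V ->
  n%:R * \sum_(1 <= j < n) sigma (lo + j%:Z) <= V ->
  0 <= alpha -> 0 <= beta ->
  (forall s : R, 0 <= s <= T -> alpha <= u s lo /\ beta <= u s (lo + n%:Z)) ->
  (0 < i < n)%N ->
  (alpha * (n%:R - i%:R) + beta * i%:R) / n%:R - (alpha + beta) * (2 * expR (- T / (2 * V)))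
    <= u T (lo + i%:Z).
Proof.
move=> sigma0 [u01 uc ud] T0 V0 HV a0 b0 Hbd /andP[i0 iltn].
have n0 : 0 < n%:R :> R by rewrite ltr0n (leq_trans _ iltn).
(* [v] solves the same equation as the expected exit time, with second difference [- 2 * sigma]
   inside. At the two ends it is only nonnegative, which suffices for a supersolution. *)
pose v (i : nat) := \sum_(1 <= j < n) sigma (lo + j%:Z) * (n%:R - `|i%:R - j%:R|).
have vbd k : (k <= n)%N -> 0 <= v k <= V.
  move=> kn; apply/andP; split.
    rewrite /v big_nat_cond; apply: sumr_ge0 => j /andP[/andP[_ jn] _].
    apply: mulr_ge0; first exact: ltW.
    rewrite subr_ge0 ler_norml.
    have : k%:R <= n%:R :> R by rewrite ler_nat.
    have : j%:R <= n%:R :> R by rewrite ler_nat ltnW.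
    have : 0 <= k%:R :> R by []. have : 0 <= j%:R :> R by [].
    by move=> *; apply/andP; split; lra.
  apply: le_trans HV; rewrite /v mulr_sumr; apply: ler_sum => j _.
  by rewrite mulrC ler_wpM2r ?(ltW (sigma0 _)) // gerBl.
have lapv k : (0 < k < n)%N -> v k.+1 + v k.-1 - 2 * v k = - 2 * sigma (lo + k%:Z).
  move=> /andP[k0 kn]; rewrite /v mulr_sumr -big_split -sumrB /=.
  transitivity (\sum_(1 <= j < n | j == k) - 2 * sigma (lo + j%:Z)).
    rewrite [RHS]big_mkcond; apply: eq_bigr => j _.
    transitivity (- sigma (lo + j%:Z) * (`|k.+1%:R - j%:R| + `|k.-1%:R - j%:R| - 2 * `|k%:R - j%:R|)).
      by ring.
    rewrite second_diff_dist // eq_sym; case: eqP => _; rewrite ?mulr1n ?mulr0n; ring.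
  by rewrite big_nat1_eq k0 kn.
pose w (s : R) := expR (- s / (2 * V)).
have w0 s : 0 < w s by exact: expR_gt0.
pose lin (i : nat) : R := (alpha * (n%:R - i%:R) + beta * i%:R) / n%:R.
(* The excess of [u] over the harmonic function [lin] with end values [alpha] and [beta], plus the
   decaying supersolution. *)
pose D (s : R) (i : nat) := u s (lo + i%:Z) - lin i + (alpha + beta) * (w s * (1 + v i / V)).
pose dD (s : R) (i : nat) := (u s (lo + i%:Z + 1) + u s (lo + i%:Z - 1) - 2 * u s (lo + i%:Z)) / (2 * sigma (lo + i%:Z))
   - (alpha + beta) * (w s / (2 * V) * (1 + v i / V)).
have ab0 : 0 <= alpha + beta by exact: addr_ge0.
have pos s k : (k <= n)%N -> 0 <= (alpha + beta) * (w s * (1 + v k / V)).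
  move=> kn; have /andP[vk0 _] := vbd k kn.
  by rewrite mulr_ge0 // mulr_ge0 ?(ltW (w0 _)) // addr_ge0 // divr_ge0 // ltW.
have linle k : (k <= n)%N -> lin k <= alpha + beta.
  move=> kn; rewrite /lin ler_pdivrMr //.
  have : k%:R <= n%:R :> R by rewrite ler_nat.
  have : 0 <= k%:R :> R by [].
  by nra.
have : 0 <= D T i.
  apply: (@max_principle _ n (fun i => (2 * sigma (lo + i%:Z))^-1) D dD T T0 _ _ _ _ _ _ i (ltnW iltn)).
  - by move=> k; rewrite invr_ge0 mulr_ge0 // ltW.
  - move=> k kn x; apply: cvgD.
      by apply: cvgB; [exact: uc|exact: cvg_cst].
    apply: cvgM; first exact: cvg_cst.
    apply: cvgM; last exact: cvg_cst.
    have cw : continuous w.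
      by move=> y; apply/differentiable_continuous/derivable1_diffP; exact: ex_derive.
    by move: x; exact: continuous_subspaceT.
  - move=> k s kn /andP[s0 sT]; have := ud s (lo + k%:Z) s0 => du.
    rewrite /D /dD /w; apply: is_derive_eq.
    by rewrite /GRing.scale /=; field; rewrite !gt_eqF.
  - move=> k s kn /andP[s0 sT].
    have /andP[k0 kltn] := kn.
    have /andP[vk0 vkV] := vbd k (ltnW kltn).
    have -> : D s k.+1 + D s k.-1 - 2 * D s k =
        (u s (lo + k%:Z + 1) + u s (lo + k%:Z - 1) - 2 * u s (lo + k%:Z))
        - (alpha + beta) * (w s * (2 * sigma (lo + k%:Z) / V)).
      rewrite /D /lin.
      have -> : lo + k.+1%:Z = lo + k%:Z + 1 by rewrite -addn1 PoszD addrA.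
      have -> : lo + k.-1%:Z = lo + k%:Z - 1 by rewrite -subn1 -subzn // addrA.
      have -> : v k.+1 = - v k.-1 + 2 * v k - 2 * sigma (lo + k%:Z).
        by have := lapv k kn; lra.
      have -> : k.-1%:R = k%:R - 1 :> R by rewrite -subn1 natrB.
      rewrite -natr1; field.
      by rewrite !gt_eqF.
    rewrite mulrBr /dD [X in X - _]mulrC lerD2l lerN2.
    have -> : (2 * sigma (lo + k%:Z))^-1 * ((alpha + beta) * (w s * (2 * sigma (lo + k%:Z) / V)))
      = (alpha + beta) * (w s / (2 * V) * 2).
      by field; rewrite !gt_eqF.
    (* What is left is [1 + v k / V <= 2]. This is where the decay rate [1 / (2 * V)], half of
       [1 / V], is used. *)
    apply: ler_wpM2l => //; apply: ler_wpM2l.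
      by rewrite divr_ge0 ?mulr_ge0 // ltW.
    by rewrite -lerBrDl (_ : 2 - 1 = 1 :> R) ?ler_pdivrMr ?mul1r //; ring.
  - move=> k kn; have /andP[vk0 _] := vbd k kn.
    have /andP[uk0 _] := u01 0 (lo + k%:Z) (lexx 0).
    rewrite /D /w oppr0 mul0r expR0 mul1r.
    have := linle k kn.
    have : 0 <= v k / V by rewrite divr_ge0 // ltW.
    by nra.
  - move=> s /[dup] sT /Hbd[ua ub]; split.
      have := pos s 0%N isT; rewrite /D /lin addr0 mulr0 addr0 subr0 mulfK ?gt_eqF //.
      by lra.
    have := pos s n (leqnn n); rewrite /D /lin subrr mulr0 add0r mulfK ?gt_eqF //.
    by lra.
have /andP[_ viV] := vbd i (ltnW iltn).
rewrite /D -/(lin i) -/(w T) => H.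
have : (alpha + beta) * (w T * (1 + v i / V)) <= (alpha + beta) * (2 * w T).
  apply: ler_wpM2l => //; rewrite mulrC ler_wpM2r ?(ltW (w0 _)) //.
  by rewrite -lerBrDl (_ : 2 - 1 = 1 :> R) ?ler_pdivrMr ?mul1r //; ring.
by lra.
Qed.

(** * Backward equation *)

Section btm_kernel.
Variables (R : realType) (sigma : int -> R).
Hypothesis sigma0 : forall z, 0 < sigma z.

Definition btm_total (y x : int) (s : R) : \bar R :=
  (\sum_(0 <= n <oo) btm_step n sigma x y s)%E.

(** The target comes first and the starting point last, so that [btm_kernel y] has the shape
    required by [heat_sol]. *)
Definition btm_kernel (y : int) (s : R) (x : int) : R := fine (btm_total y x s).

Lemma btm_total_ge0 y x s : (0 <= btm_total y x s)%E.
Proof. by apply: nneseries_ge0 => n _ _; exact: btm_step_ge0. Qed.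

Lemma btm_total_meas y x : measurable_fun setT (btm_total y x).
Proof.
apply: ge0_emeasurable_sum; first by move=> k w _ _; exact: btm_step_ge0.
by move=> k _; exact: btm_step_meas.
Qed.

(** The starting point equals at most one of two distinct targets, so the sum of the two kernels
    still satisfies the hypothesis of [renewal_le1] on its jump-free term. *)
Lemma btm_total_pair_le1 (x y z : int) (s : R) : y != z -> 0 <= s ->
  (btm_total y x s + btm_total z x s <= 1)%E.
Proof.
move=> yz s0.
pose g (n : nat) (x : int) (s : R) := (btm_step n sigma x y s + btm_step n sigma x z s)%E.
have g0 n w r : (0 <= g n w r)%E by apply: adde_ge0; exact: btm_step_ge0.
rewrite /btm_total -nneseriesD; try by move=> n _ _; exact: btm_step_ge0.
apply: (@renewal_le1 R sigma sigma0 g g0).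
- by move=> n w; apply: emeasurable_funD; exact: btm_step_meas.
- move=> n w r; rewrite /g jump_intD //; try by move=> v; exact: btm_step_meas.
  by move=> v q; exact: btm_step_ge0.
  by move=> v q; exact: btm_step_ge0.
- move=> w r r0; rewrite /g /= -EFinD lee_fin -mulrDl ger_pMl ?expR_gt0 //.
  have [->|] := eqVneq w y; first by rewrite (negbTE yz) addr0.
  by rewrite add0r; case: (w == z).
- exact: s0.
Qed.

Lemma btm_total_le1 (x y : int) (s : R) : 0 <= s -> (btm_total y x s <= 1)%E.
Proof.
move=> s0; have yz : y != y + 1 by lia.
apply: le_trans (btm_total_pair_le1 x yz s0).
by apply: leeDl; exact: btm_total_ge0.
Qed.

Lemma btm_total_fin (x y : int) (s : R) : 0 <= s -> btm_total y x s = (btm_kernel y s x)%:E.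
Proof.
move=> s0; rewrite fineK // ge0_fin_numE ?btm_total_ge0 //.
by apply: le_lt_trans (btm_total_le1 x y s0) _; rewrite ltry.
Qed.

Lemma btm_kernel01 (x y : int) (s : R) : 0 <= s -> 0 <= btm_kernel y s x <= 1.
Proof.
move=> s0; rewrite -!lee_fin -btm_total_fin // btm_total_ge0 /=.
exact: btm_total_le1.
Qed.

Lemma btm_kernel_pair_le1 (x y z : int) (s : R) : y != z -> 0 <= s ->
  btm_kernel y s x + btm_kernel z s x <= 1.
Proof.
move=> yz s0; rewrite -lee_fin EFinD -!btm_total_fin //.
exact: btm_total_pair_le1.
Qed.

(** The integrand of the renewal equation after time reversal, with [expR (- s / sigma x)] factored
    out. Time then enters the integral only through its upper limit. *)
Let h (y x : int) (r : R) : R :=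
  expR (r / sigma x) * (btm_kernel y r (x + 1) + btm_kernel y r (x - 1)) / (2 * sigma x).

Lemma btm_total_renewal (y x : int) (s : R) :
  btm_total y x s =
  (((x == y)%:R * expR (- s / sigma x))%:E + jump_int sigma x s (btm_total y))%E.
Proof.
rewrite /btm_total (@renewal_series R sigma sigma0 (fun n x s => btm_step n sigma x y s)) //.
  by move=> n z r; exact: btm_step_ge0.
by move=> n z; exact: btm_step_meas.
Qed.

Let mh y x : measurable_fun setT (h y x).
Proof.
have mk z : measurable_fun setT (fun r => btm_kernel y r z).
  by apply: measurableT_comp => //; exact: btm_total_meas.
apply: measurable_funM => //; apply: measurable_funM; last exact: measurable_funD.
by apply: measurableT_comp => //; apply: measurable_funM.
Qed.

Let h_ge0 y x r : 0 <= r -> 0 <= h y x r.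
Proof.
move=> r0; have /andP[? _] := btm_kernel01 (x + 1) y r0.
have /andP[? _] := btm_kernel01 (x - 1) y r0.
by rewrite /h divr_ge0 ?mulr_ge0 ?addr_ge0 ?expR_ge0 // ltW.
Qed.

Let h_integrable y x (T : R) : (@lebesgue_measure R).-integrable `[0, T] (EFin \o h y x).
Proof.
apply: measurable_bounded_integrable; [by []| |by apply: measurable_funTS; exact: mh|].
  rewrite /= lebesgue_measure_itv /= lte_fin.
  by case: ifP => // _; rewrite -EFinB ltry.
exists (expR (T / sigma x) / sigma x); split; first exact: num_real.
move=> M TM r /=; rewrite in_itv /= => /andP[r0 rT].
apply: le_trans (ltW TM); rewrite ger0_norm ?h_ge0 //.
have /andP[? ?] := btm_kernel01 (x + 1) y r0.
have /andP[? ?] := btm_kernel01 (x - 1) y r0.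
rewrite /h invfM mulrA ler_pM2r ?invr_gt0 // ler_pdivrMr //.
apply: ler_pM; [exact: expR_ge0|exact: addr_ge0| |lra].
by rewrite ler_expR ler_pM2r ?invr_gt0.
Qed.

Lemma btm_kernel_eq (y x : int) (s : R) : 0 <= s ->
  btm_kernel y s x = expR (- s / sigma x) *
    ((x == y)%:R + \int[@lebesgue_measure R]_(r in `[0, s]) h y x r).
Proof.
move=> s0; apply: EFin_inj; rewrite -btm_total_fin // btm_total_renewal.
rewrite mulrDr EFinD [in RHS]mulrC; congr (_ + _)%E.
pose k r : \bar R := ((sigma x)^-1 * expR (- r / sigma x) / 2)%R%:E.
pose f r := (k (s - r)%R * (btm_total y (x + 1)%R r + btm_total y (x - 1)%R r))%E.
have mf : measurable_fun setT f.
  apply: emeasurable_funM.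
    by apply: measurable_reverse => //; exact: jump_kernel_meas.
  by apply: emeasurable_funD; exact: btm_total_meas.
have f0 r : (0 <= f r)%E.
  apply: mule_ge0; first exact: jump_kernel_ge0.
  by apply: adde_ge0; exact: btm_total_ge0.
transitivity (\int[@lebesgue_measure R]_(r in [set r : R | (0 <= r <= s)%R]) f (s - r)%R)%E.
  by apply: eq_integral => r _; rewrite /f /k (_ : s - (s - r) = r) //; ring.
rewrite integral_flip //.
transitivity (\int[@lebesgue_measure R]_(r in `[0%R, s]) ((expR (- s / sigma x))%R%:E * (h y x r)%:E))%E.
  apply: eq_integral => r; rewrite inE /= => /andP[r0 rs].
  rewrite /f /k !btm_total_fin // -EFinD -!EFinM; congr EFin.
  rewrite (_ : - (s - r) / sigma x = - s / sigma x + r / sigma x); last by field; rewrite gt_eqF.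
  by rewrite expRD /h; field; rewrite gt_eqF.
have hi := h_integrable y x s.
rewrite ge0_integralZl_EFin ?expR_ge0 //.
- rewrite EFinM /Rintegral fineK //.
  by apply: integrable_fin_num.
- by move=> r /=; rewrite in_itv /= lee_fin => /andP[r0 _]; exact: h_ge0.
- by apply/measurable_EFinP; apply: measurable_funTS; exact: mh.
Qed.

(** Regularity is bootstrapped: a bounded measurable [h] makes the kernel continuous, hence [h] is
    continuous at positive times, and the fundamental theorem of calculus then gives the
    derivative. *)
Lemma btm_kernel_continuous (y x : int) (T : R) : 0 <= T ->
  {within `[0, T], continuous (fun s => btm_kernel y s x)}.
Proof.
move=> T0; pose F s := expR (- s / sigma x) *
    ((x == y)%:R + \int[@lebesgue_measure R]_(r in `[0, s]) h y x r).
apply: (@subspace_eq_continuous _ _ _ (F : subspace _ -> R)).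
  move=> s; rewrite /from_subspace inE /= in_itv /= => /andP[s0 _].
  by rewrite btm_kernel_eq.
move=> s; apply: cvgM.
  have cE : continuous (fun s : R => expR (- s / sigma x)).
    by move=> z; apply/differentiable_continuous/derivable1_diffP; exact: ex_derive.
  by move: s; exact: continuous_subspaceT.
apply: cvgD; first exact: cvg_cst.
exact: (parameterized_integral_continuous T0 (h_integrable y x T)).
Qed.

Lemma btm_kernel_derive (y x : int) (s : R) : 0 < s ->
  is_derive s 1 (fun s => btm_kernel y s x)
    ((btm_kernel y s (x + 1) + btm_kernel y s (x - 1) - 2 * btm_kernel y s x) / (2 * sigma x)).
Proof.
move=> s0; pose I s := \int[@lebesgue_measure R]_(r in `[0, s]) h y x r.
pose F s := expR (- s / sigma x) * ((x == y)%:R + I s).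
have s1 : s < s + 1 by rewrite ltrDl.
have ck z : {for s, continuous (fun r => btm_kernel y r z)}.
  apply: (@within_continuous_continuous _ _ _ 0 (s + 1)).
  - by rewrite addr_gt0.
  - by apply: btm_kernel_continuous; rewrite addr_ge0 // ltW.
  - by rewrite in_itv /= s0 s1.
have ch : {for s, continuous (h y x)}.
  have cE : {for s, continuous (fun s : R => expR (s / sigma x))}.
    by apply/differentiable_continuous/derivable1_diffP; exact: ex_derive.
  apply: cvgM; last exact: cvg_cst.
  by apply: cvgM; [exact: cE|apply: cvgD; exact: ck].
have [dI I's] := continuous_FTC1_closed s1 (h_integrable y x (s + 1)) s0 ch.
have dI' : is_derive s 1 I (h y x s).
  by apply: DeriveDef; [exact: dI|rewrite -derive1E; exact: I's].
apply: (@near_eq_is_derive _ _ _ F).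
  near=> r; rewrite btm_kernel_eq //.
  by apply: ltW; near: r; exact: lt_nbhsr.
rewrite (_ : _ / _ = - (sigma x)^-1 * F s + expR (- s / sigma x) * h y x s); last first.
  rewrite /F /I -btm_kernel_eq ?(ltW s0) // /h (mulNr s) expRN.
  by field; rewrite !gt_eqF // expR_gt0.
by apply: is_derive_eq; rewrite /F /GRing.scale /=; ring.
Unshelve. all: by end_near. Qed.

Lemma btm_kernel_heat_sol (y : int) : heat_sol sigma (btm_kernel y).
Proof.
split; [by move=> s x; exact: btm_kernel01|by move=> T x; exact: btm_kernel_continuous|].
by move=> s x; exact: btm_kernel_derive.
Qed.

Lemma btm_kernel0 (y : int) : btm_kernel y 0 y = 1.
Proof.
by rewrite btm_kernel_eq // oppr0 mul0r expR0 mul1r eqxx set_itv1 Rintegral_set1 addr0.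
Qed.

Lemma btm_probE (t : R) (y : int) : btm_prob sigma t y = btm_kernel y t 0.
Proof. by []. Qed.
End btm_kernel.

(** * Environments with two isolated deep traps *)

(** The lower bounds have main terms [a / (a + b)] at the right trap and [b / (a + b)] at the left
    one. These add up to one and the two probabilities to at most one, so each lower bound gives an
    upper bound for the other probability. *)
Lemma btm_two_traps (R : realType) (sigma : int -> R) (a b m : nat) (t V A kappa : R) :
  (forall z, 0 < sigma z) -> (0 < a)%N -> (0 < b)%N -> (0 < m)%N -> 0 <= t -> 0 < V ->
  0 <= kappa <= 1 ->
  (forall y, y = b%:Z \/ y = - a%:Z ->
     \sum_(1 <= k < m) (sigma (y + k%:Z) + sigma (y - k%:Z)) <= A /\
     (t / m%:R + A) / sigma y <= kappa) ->
  (a + b)%:R * \sum_(1 <= j < a + b) sigma (- a%:Z + j%:Z) <= V ->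
  let err := kappa + 2 * expR (- t / (2 * V)) in
  `| btm_prob sigma t b%:Z + b%:R / (b%:R + a%:R) - 1 | <= err /\
  `| btm_prob sigma t (- a%:Z) + a%:R / (b%:R + a%:R) - 1 | <= err.
Proof.
move=> sigma0 a0 b0 m0 t0 V0 /andP[k0 k1] Htrap HV err.
have stay y : y = b%:Z \/ y = - a%:Z -> forall s : R, 0 <= s <= t ->
    1 - kappa <= btm_kernel sigma y s y.
  move=> /Htrap[HA Hk] s /andP[s0 st].
  apply: le_trans (stay_near sigma0 (btm_kernel_heat_sol sigma0 y) (btm_kernel0 sigma0 y) m0 s0).
  rewrite lerD2l lerN2; apply: le_trans Hk.
  rewrite ler_pM2r ?invr_gt0 //; apply: lerD => //.
  by rewrite ler_pM2r // invr_gt0 ltr0n.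
have ge0 y x s : 0 <= s -> 0 <= btm_kernel sigma y s x.
  by move=> s0; have /andP[] := btm_kernel01 sigma0 x y s0.
have hi : - a%:Z + (a + b)%N%:Z = b%:Z by lia.
have mid : - a%:Z + a%:Z = 0 by lia.
have ai : (0 < a < a + b)%N by lia.
have k1' : 0 <= 1 - kappa by rewrite subr_ge0.
(* The interval runs from [- a] to [b], so the origin has index [a]. The trap aimed at gets the end
   value [1 - kappa] provided by [stay_near], the other end gets [0]. *)
have Hb := @hitting_lower_bound _ sigma _ (- a%:Z) (a + b) t V 0 (1 - kappa) a sigma0
  (btm_kernel_heat_sol sigma0 b%:Z) t0 V0 HV (lexx 0) k1'.
have Ha := @hitting_lower_bound _ sigma _ (- a%:Z) (a + b) t V (1 - kappa) 0 a sigma0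
  (btm_kernel_heat_sol sigma0 (- a%:Z)) t0 V0 HV k1' (lexx 0).
rewrite hi mid in Hb Ha.
have {}Hb := Hb _ ai; have {}Ha := Ha _ ai.
have {Hb}Hb : (0 * ((a + b)%:R - a%:R) + (1 - kappa) * a%:R) / (a + b)%:R -
     (0 + (1 - kappa)) * (2 * expR (- t / (2 * V))) <= btm_kernel sigma b%:Z t 0.
  apply: Hb => s st; split; first by apply: ge0; case/andP: st.
  by apply: stay => //; left.
have {Ha}Ha : ((1 - kappa) * ((a + b)%:R - a%:R) + 0 * a%:R) / (a + b)%:R -
     (1 - kappa + 0) * (2 * expR (- t / (2 * V))) <= btm_kernel sigma (- a%:Z) t 0.
  apply: Ha => s st; split; last by apply: ge0; case/andP: st.
  by apply: stay => //; right.
have ba : b%:Z != - a%:Z by lia.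
have sum1 := btm_kernel_pair_le1 sigma0 0 ba t0.
rewrite !btm_probE.
move: Hb Ha sum1.
set pb := btm_kernel _ _ _ _; set pa := btm_kernel _ _ _ _.
set e := expR _ in err *; rewrite natrD.
have e0 : 0 < e by exact: expR_gt0.
have A0 : 0 < a%:R :> R by rewrite ltr0n.
have B0 : 0 < b%:R :> R by rewrite ltr0n.
rewrite [a%:R + b%:R]addrC.
set x := a%:R / (b%:R + a%:R); set y := b%:R / (b%:R + a%:R).
have xy : x + y = 1 by rewrite /x /y; field; rewrite gt_eqF // addr_gt0.
have x0 : 0 <= x by rewrite divr_ge0 ?addr_ge0 // ltW.
have y0 : 0 <= y by rewrite divr_ge0 ?addr_ge0 // ltW.
rewrite mul0r add0r add0r.
have -> : (1 - kappa) * a%:R / (b%:R + a%:R) = (1 - kappa) * x by rewrite -mulrA.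
rewrite mul0r !addr0 addrK.
have -> : (1 - kappa) * b%:R / (b%:R + a%:R) = (1 - kappa) * y by rewrite -mulrA.
move=> Hb Ha sum1.
have ke : 0 <= kappa * e by rewrite mulr_ge0 // ltW.
have kx : kappa * x <= kappa by rewrite ler_piMr //; lra.
have ky : kappa * y <= kappa by rewrite ler_piMr //; lra.
have Hb' : x - err <= pb by rewrite /err; nra.
have Ha' : y - err <= pa by rewrite /err; nra.
by rewrite !ler_norml; split; apply/andP; split; lra.
Qed.

(** * Finite windows and deterministic conditions on the environment *)

Definition window (H : nat) : seq int := [seq i%:Z - H%:Z | i <- iota 0 (2 * H).+1].

Lemma mem_window (H : nat) (z : int) : (z \in window H) = (`|z| <= H)%N.
Proof.
apply/mapP/idP => [[i]|zH].
  by rewrite mem_iota => iH ->; lia.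
by exists (absz (z + H%:Z)); [rewrite mem_iota|]; lia.
Qed.

Lemma uniq_window (H : nat) : uniq (window H).
Proof. by rewrite map_inj_uniq ?iota_uniq // => i j; lia. Qed.

Lemma size_window (H : nat) : size (window H) = (2 * H).+1.
Proof. by rewrite size_map size_iota. Qed.

Lemma window_sum_ge (R : realType) (f : int -> R) (H : nat) (s : seq int) :
  (forall z, 0 <= f z) -> uniq s -> (forall z, z \in s -> (`|z| <= H)%N) ->
  \sum_(z <- s) f z <= \sum_(z <- window H) f z.
Proof.
move=> f0 us sH.
rewrite (perm_big [seq z <- window H | z \in s]).
  rewrite big_filter big_mkcond; apply: ler_sum => z _.
  by case: ifP => // _.
apply: uniq_perm => //; first by rewrite filter_uniq // uniq_window.
move=> z; rewrite mem_filter mem_window; apply/idP/andP => [zs|[]//].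
by split => //; exact: sH.
Qed.

(** Deep sites count as zero rather than as [l]: a sum of these terms is the mass of the landscape
    with its traps removed. *)
Definition shallow (R : realType) (l s : R) : R := if s <= l then s else 0.

Lemma first_trap (R : realType) (f : nat -> R) (l : R) (H : nat) :
  (exists2 k, (0 < k <= H)%N & l < f k) ->
  exists k, [/\ (0 < k <= H)%N, l < f k & forall j, (0 < j < k)%N -> f j <= l].
Proof.
move=> [k0 k0H k0l].
have ex : exists k, (0 < k)%N && (l < f k).
  by exists k0; rewrite k0l andbT; case/andP: k0H.
case: (ex_minnP ex) => k /andP[k_gt0 kl] kmin; exists k; split => //.
  rewrite k_gt0; case/andP: k0H => ? /(leq_trans _); apply.
  by apply: kmin; apply/andP.
move=> j /andP[j0 jk]; rewrite leNgt; apply/negP => lj.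
by have := kmin j; rewrite j0 lj leqNgt jk => /(_ isT).
Qed.

(* [lia] preprocesses every hypothesis, including the many irrelevant ones about reals. *)
Ltac int_lia :=
  match goal with
  | RR : realType |- _ => repeat match goal with H : context [RR] |- _ => clear H end
  end; lia.

(** Reduces [btm_two_traps] to properties that each hold with high probability. The traps lie within
    [H] of the origin and their neighbourhoods have radius [m <= H], whence the window of radius
    [2 * H]. *)
Lemma good_environment (R : realType) (sigma : int -> R) (l t delta K kappa : R) (m H : nat) :
  (forall z, 0 < sigma z) -> (0 < m <= H)%N -> 0 < l -> 0 <= t -> 0 < delta -> 0 < K ->
  kappa <= 1 -> (t / m%:R + 2 * delta * l) / (K * l) <= kappa ->
  (forall z, (`|z| <= m)%N -> sigma z <= l) ->
  (exists2 k, (0 < k <= H)%N & l < sigma k%:Z) ->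
  (exists2 k, (0 < k <= H)%N & l < sigma (- k%:Z)) ->
  (forall z, (`|z| <= 2 * H)%N -> l < sigma z -> K * l < sigma z) ->
  \sum_(z <- window (2 * H)) shallow l (sigma z) <= delta * l ->
  (forall z k, (`|z| <= 2 * H)%N -> (0 < k <= m)%N -> l < sigma z -> sigma (z + k%:Z) <= l) ->
  let Z (i : bool) := if i then Z1 sigma l else Z2 sigma l in
  forall i, `| btm_prob sigma t (Z i) + `|Z i|%:~R / (`|Z true|%:~R + `|Z false|%:~R) - 1 |
    <= kappa + 2 * expR (- t / (4 * H%:R * delta * l)).
Proof.
move=> sigma0 /andP[m0 mH] l0 t0 delta0 K0 k1 Hk G1 /first_trap[b [/andP[b0 bH] bl bmin]].
move=> /first_trap[a [/andP[a0 aH] al amin]] G3 G4 G5 Z.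
have bm : (m < b)%N.
  by rewrite ltnNge; apply/negP => bm; move: bl; rewrite ltNge G1.
have am : (m < a)%N.
  by rewrite ltnNge; apply/negP => am; move: al; rewrite ltNge G1 //; int_lia.
have Z1E : Z1 sigma l = b%:Z.
  apply: xget_unique.
    split; [int_lia|split => // y y0 yb].
    have : sigma `|y|%N%:Z <= l by apply: bmin; int_lia.
    by rewrite (_ : `|y|%N%:Z = y) //; int_lia.
  move=> y [y0 [ly ymin]].
  have [yb|yb|//] := ltgtP y b%:Z.
    have : sigma `|y|%N%:Z <= l by apply: bmin; int_lia.
    by rewrite (_ : `|y|%N%:Z = y) ?leNgt ?ly //; int_lia.
  have : sigma b%:Z <= l by apply: ymin; int_lia.
  by rewrite leNgt bl.
have Z2E : Z2 sigma l = - a%:Z.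
  apply: xget_unique.
    split; [int_lia|split => // y ya y0].
    (* The range of [Z2] includes the origin, about which [amin] says nothing. [G1] covers it. *)
    have [y1|y1] := leqP `|y|%N m; first exact: G1.
    have : sigma (- `|y|%N%:Z) <= l by apply: amin; int_lia.
    by rewrite (_ : - `|y|%N%:Z = y) //; int_lia.
  move=> y [y0 [ly ymin]].
  have ny : (0 < `|y|)%N.
    rewrite lt0n; apply/negP => /eqP yE; move: ly; rewrite ltNge G1 //; int_lia.
  have [ya|ya|//] := ltgtP y (- a%:Z).
    have : sigma (- a%:Z) <= l by apply: ymin; int_lia.
    by rewrite leNgt al.
  have : sigma (- `|y|%N%:Z) <= l by apply: amin; int_lia.
  by rewrite (_ : - `|y|%N%:Z = y) ?leNgt ?ly //; int_lia.
have sh0 z : 0 <= shallow l (sigma z) by rewrite /shallow; case: ifP => // _; exact: ltW.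
have shE z : sigma z <= l -> sigma z = shallow l (sigma z) by rewrite /shallow => ->.
(* Any family of distinct shallow sites in the window has mass at most [delta * l], being part of
   the sum in [G4]. *)
have block (g : nat -> int) i j : injective g ->
    (forall k, (i <= k < j)%N -> (`|g k| <= 2 * H)%N /\ sigma (g k) <= l) ->
    \sum_(i <= k < j) sigma (g k) <= delta * l.
  move=> ginj gk; apply: le_trans G4.
  rewrite (_ : \sum_(_ <= _ < _) _ = \sum_(z <- [seq g k | k <- index_iota i j]) shallow l (sigma z)).
    apply: window_sum_ge => //; first by rewrite map_inj_uniq // iota_uniq.
    by move=> _ /mapP[k kij ->]; have [] := gk k; rewrite -?mem_index_iota.
  rewrite big_map; apply: eq_big_seq => k; rewrite mem_index_iota => kij.
  by apply: shE; have [] := gk k.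
have H0 : 0 < H%:R :> R by rewrite ltr0n (leq_trans m0).
have V0 : 0 < 2 * H%:R * delta * l by rewrite !mulr_gt0.
have k0 : 0 <= kappa.
  apply: le_trans Hk; apply: divr_ge0; last by rewrite mulr_ge0 // ltW.
  apply: addr_ge0; first exact: divr_ge0.
  by rewrite !mulr_ge0 // ltW.
have b0' : (0 < b)%N by int_lia.
have kk : 0 <= kappa <= 1 by rewrite k0.
(* [V] is the largest possible length [2 * H] times the shallow mass [delta * l]. [A] counts
   [delta * l] once for each side of a trap. *)
have [||/=] := @btm_two_traps R sigma a b m t (2 * H%:R * delta * l) (2 * delta * l) kappa
  sigma0 a0 b0 m0 t0 V0 kk.
- move=> y yE.
  have yl : l < sigma y by case: yE => ->.
  have yH : (`|y| <= H)%N by case: yE => ->; int_lia.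
  split; last first.
    apply: le_trans Hk; rewrite ler_pM2l; last first.
      apply: ltr_wpDl; first exact: divr_ge0.
      by rewrite !mulr_gt0.
    rewrite lef_pV2 ?posrE ?mulr_gt0 //; apply: ltW; apply: G3 => //; int_lia.
  rewrite big_split /= (_ : 2 * delta * l = delta * l + delta * l); last by ring.
  apply: lerD.
    apply: (block (fun k => y + k%:Z)); first by move=> i j; int_lia.
    move=> k /andP[k0' km]; split; first int_lia.
    by apply: G5 => //; int_lia.
  apply: (block (fun k => y - k%:Z)); first by move=> i j; int_lia.
  move=> k /andP[k0' km]; split; first int_lia.
  (* Isolation in [G5] looks only to the right, so a left neighbour is handled by applying it at
     that neighbour: were it deep, the trap [y] would be shallow. *)
  rewrite leNgt; apply/negP => lk.
  have : sigma (y - k%:Z + k%:Z) <= l by apply: G5 => //; int_lia.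
  by rewrite subrK leNgt yl.
- apply: (@le_trans _ _ ((2 * H%:R) * (delta * l))); last by rewrite mulrA.
  apply: ler_pM => //.
  + by apply: sumr_ge0 => j _; exact: ltW.
  + by rewrite -natrM ler_nat; int_lia.
  apply: block; first by move=> i j; int_lia.
  move=> k /andP[k0' kn]; split; first int_lia.
  have [lt|lt|ea] := ltngtP k a.
  + have : sigma (- (a - k)%N%:Z) <= l by apply: amin; int_lia.
    by rewrite (_ : - (a - k)%N%:Z = - a%:Z + k%:Z) //; int_lia.
  + have : sigma (k - a)%N%:Z <= l by apply: bmin; int_lia.
    by rewrite (_ : (k - a)%N%:Z = - a%:Z + k%:Z) //; int_lia.
  + by rewrite ea addNr; apply: G1.
rewrite (_ : 2 * (2 * H%:R * delta * l) = 4 * H%:R * delta * l); last by ring.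
move=> P1 P2 i; rewrite /Z Z1E Z2E; case: i.
  by move: P1; congr (`|_ + _ / _ - 1| <= _); rewrite ?normrN.
by move: P2; congr (`|_ + _ / _ - 1| <= _); rewrite ?normrN.
Qed.

(** * Slow variation *)

(* One dyadic step multiplies [V l / (l q l)] by at most [(1 + th) / 2 <= 3 / 4] and adds [th]. *)
Lemma karamata_truncated (R : realType) (q : R -> R) :
  (forall x, 0 < q x) -> (forall x y, x <= y -> q y <= q x) ->
  (forall th : R, 0 < th -> exists2 x0 : R, 0 < x0 & forall x, x0 <= x -> q x <= (1 + th) * q (2 * x)) ->
  forall rho : R, 0 < rho -> exists2 l1 : R, 0 < l1 & forall V : R -> R,
    (forall l : R, 0 < l -> V l <= l) ->
    (forall l : R, 0 < l -> V (2 * l) <= V l + 2 * l * (q l - q (2 * l))) ->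
    forall l, l1 <= l -> V l <= rho * l * q l.
Proof.
move=> q0 qle qsv rho rho0.
(* [th <= 1 / 2] gives the contraction factor [3 / 4], and [th <= rho / 8] makes the limiting
   constant [4 * th] at most [rho / 2]. *)
pose th : R := Num.min (1 / 2) (rho / 8).
have th0 : 0 < th by rewrite lt_min !divr_gt0.
have th1 : th <= 1 / 2 by rewrite ge_min lexx.
have th2 : th <= rho / 8 by rewrite ge_min lexx orbT.
have [x0 x00 Hx0] := qsv th th0.
(* On the first dyadic block [C * q l >= 1], so the trivial bound [V l <= l] starts the
   induction. *)
pose C := (q (2 * x0))^-1.
have C0 : 0 < C by rewrite invr_gt0.
have [k0 Hk0] : exists k0, forall k, (k0 <= k)%N -> (3 / 4 : R) ^+ k * C <= rho / 2.
  have : (3 / 4 : R) ^+ k @[k --> \oo] --> 0.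
    by apply: cvg_expr; rewrite ger0_norm; lra.
  move=> /cvgrPdist_le /(_ (rho / 2 / C)) [|k0 _ Hk]; first by rewrite !divr_gt0.
  exists k0 => k kk; have p0 : 0 <= (3 / 4 : R) ^+ k by apply: exprn_ge0; lra.
  by have := Hk k kk; rewrite sub0r normrN ger0_norm // ler_pdivlMr.
exists (2 ^+ k0 * x0); first by rewrite mulr_gt0 // exprn_gt0.
move=> V V1 V2.
(* The additive constant [4 * th] is the fixed point of [r] to [3 / 4 * r + th]; only the part
   carrying [C] contracts from block to block. *)
have level k : forall l, 2 ^+ k * x0 <= l -> l <= 2 ^+ k.+1 * x0 ->
    V l <= ((3 / 4) ^+ k * C + 4 * th) * l * q l.
  elim: k => [|k IH] l l1 l2.
    rewrite expr0 mul1r in l1; rewrite expr1 in l2.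
    have l0 : 0 < l by exact: lt_le_trans l1.
    apply: (le_trans (V1 l l0)).
    have : 1 <= C * q l.
      by rewrite /C ler_pdivlMl // mulr1; exact: qle.
    have : 0 <= th * l * q l by rewrite !mulr_ge0 // ltW.
    rewrite expr0 mul1r => Hth HC.
    have : l * 1 <= l * (C * q l) by rewrite ler_pM2l.
    by lra.
  pose l' := l / 2.
  have ll' : l = 2 * l' by rewrite /l'; field.
  have l'1 : 2 ^+ k * x0 <= l' by rewrite exprS in l1; lra.
  have l'2 : l' <= 2 ^+ k.+1 * x0 by rewrite exprS in l2; lra.
  have pk : 1 <= 2 ^+ k :> R by rewrite exprn_ege1 // ler1n.
  have l'x : x0 <= l'.
    by apply: le_trans l'1; rewrite ler_peMl // ltW.
  have l'0 : 0 < l' by exact: lt_le_trans l'x.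
  have := IH l' l'1 l'2; have := V2 l' l'0; have := Hx0 l' l'x.
  rewrite -ll'; set c := (3 / 4) ^+ k * C.
  have -> : (3 / 4) ^+ k.+1 * C = 3 / 4 * c by rewrite /c exprS mulrA.
  have c0 : 0 < c by rewrite mulr_gt0 // exprn_gt0; lra.
  have := q0 l; set Q := q l; set Q' := q l' => Q0 HQ HV HI.
  have A1 : (c + 4 * th) * l' * Q' <= (c + 4 * th) * l' * ((1 + th) * Q).
    by rewrite ler_pM2l // mulr_gt0 //; lra.
  have A2 : 2 * l' * (Q' - Q) <= 2 * l' * (th * Q).
    by rewrite ler_pM2l; lra.
  have lQ : 0 < l' * Q by rewrite mulr_gt0.
  have A3 : (c + 4 * th) * (1 + th) * (l' * Q) <= (c + 4 * th) * (3 / 2) * (l' * Q).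
    by rewrite ler_pM2r // ler_pM2l; lra.
  have E1 : l * (Q' - Q) = 2 * l' * (Q' - Q) by rewrite {1}ll'.
  rewrite [X in _ <= _ * X * _]ll'.
  by lra.
move=> l hl.
have ex : exists k, l <= 2 ^+ k.+1 * x0.
  exists (Num.truncn (l / x0)).+1.
  rewrite -ler_pdivrMr //; apply: ltW; apply: lt_le_trans (Num.Theory.truncnS_gt _) _.
  rewrite -natrX ler_nat; apply: (@leq_trans (2 ^ (Num.truncn (l / x0)).+1)); first exact/ltnW/ltn_expl.
  by rewrite leq_exp2l.
case: (ex_minnP ex) => k lk kmin.
(* A least block index below [k0] is possible only if [l] equals [2 ^+ k0 * x0], which is also the
   left end of block [k0]. *)
have [kk|kk] := leqP k0 k; last first.
  have : 2 ^+ k.+1 * x0 <= 2 ^+ k0 * x0.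
    by rewrite ler_pM2r // ler_weXn2l // ler1n.
  move=> H; have le : l = 2 ^+ k0 * x0 by apply/eqP; rewrite eq_le hl (le_trans lk H).
  have := level k0 l; rewrite le lexx ler_pM2r // ler_weXn2l ?ler1n // => /(_ isT isT) /le_trans; apply.
  have := Hk0 k0 (leqnn _); set l0 := _ * x0 => Hk.
  have l00 : 0 < l0 * q l0 by rewrite mulr_gt0 // mulr_gt0 // exprn_gt0.
  by rewrite -2!mulrA ler_pM2r //; lra.
have kl : 2 ^+ k * x0 <= l.
  case: k lk kmin kk => [|k] lk kmin kk.
    move: hl; move: kk; rewrite leqn0 => /eqP ->; done.
  rewrite leNgt; apply/negP => H.
  by have := kmin k (ltW H); rewrite ltnn.
apply: (le_trans (level k l kl lk)).
have := Hk0 k kk => Hk.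
have l0 : 0 < l by apply: lt_le_trans hl; rewrite mulr_gt0 // exprn_gt0.
have : 0 < l * q l by rewrite mulr_gt0.
by move=> ?; rewrite -2!mulrA ler_pM2r //; lra.
Qed.

(** [L] may jump at its level, so [t] is compared with [s * L s] at half and at twice [ell L t]. The
    doubling hypothesis brings both values back to [ell L t] at the cost of constants. *)
Lemma ell_bounds (R : realType) (L : R -> R) :
  (forall x, 1 <= L x) -> (forall x y, x <= y -> L x <= L y) ->
  (exists2 x0 : R, 0 < x0 & forall x, x0 <= x -> L (2 * x) <= 3 / 2 * L x) ->
  forall M : R, \forall t \near +oo, [/\ M <= ell L t, 0 < ell L t,
     ell L t * L (ell L t) / 4 <= t & t <= 3 * (ell L t * L (ell L t))].
Proof.
move=> L1 Lmono [x0 x00 Lsv] M.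
(* The doubling hypothesis is also applied at half the level, hence [2 * x0]. *)
pose M' := Num.max M (2 * x0).
have M'M : M <= M' by rewrite le_max lexx.
have M'x : 2 * x0 <= M' by rewrite le_max lexx orbT.
have M'0 : 0 < M' by apply: lt_le_trans M'x; rewrite mulr_gt0.
near=> t.
have t0 : 0 < t by near: t; apply: nbhs_pinfty_gt; exact: num_real.
have tM : M' * L M' < t by near: t; apply: nbhs_pinfty_gt; exact: num_real.
pose A := [set s : R | 0 <= s /\ t <= s * L s].
have At : A t by split; [exact: ltW|rewrite ler_peMr // ltW].
have lbA : has_lbound A by exists 0 => s [].
have hiA : has_inf A by split => //; exists t.
have ellE : ell L t = inf A by [].
have geM : M' <= ell L t.
  rewrite ellE; apply: lb_le_inf; first by exists t.
  move=> s [s0 ts]; rewrite leNgt; apply/negP => sM.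
  have : s * L s <= M' * L M'.
    by apply: ler_pM => //; [exact: le_trans (L1 s)|exact: ltW|exact/Lmono/ltW].
  by lra.
have l0 : 0 < ell L t by exact: lt_le_trans geM.
have up s : ell L t < s -> t <= s * L s.
  move=> ls; have [a [a0 ta] as_] := inf_lt (ex_intro _ t At) ls.
  apply: (le_trans ta); apply: ler_pM => //; [|exact: ltW|exact/Lmono/ltW].
  exact: le_trans (L1 a).
have dn s : 0 <= s -> s < ell L t -> s * L s <= t.
  move=> s0 sl; rewrite leNgt; apply/negP => ts.
  have : ell L t <= s by rewrite ellE; apply: ge_inf => //; split => //; exact: ltW.
  by rewrite leNgt sl.
split => //.
- exact: le_trans geM.
- have Hd : ell L t / 2 * L (ell L t / 2) <= t by apply: dn; lra.
  have : L (2 * (ell L t / 2)) <= 3 / 2 * L (ell L t / 2) by apply: Lsv; lra.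
  rewrite (_ : 2 * (ell L t / 2) = ell L t); last by field.
  set a := L _; set b := L (_ / 2) in Hd * => ab.
  have b1 : 1 <= b by exact: L1.
  have : ell L t * a <= ell L t * (3 / 2 * b) by rewrite ler_pM2l.
  have : 0 < ell L t * b by rewrite mulr_gt0 //; lra.
  by lra.
- have Hu : t <= 2 * ell L t * L (2 * ell L t) by apply: up; lra.
  have : L (2 * ell L t) <= 3 / 2 * L (ell L t) by apply: Lsv; lra.
  move=> H; apply: (le_trans Hu).
  have : ell L t * L (2 * ell L t) <= ell L t * (3 / 2 * L (ell L t)) by rewrite ler_pM2l.
  by lra.
Unshelve. all: by end_near. Qed.

(** * Tails and bad events *)

Lemma measurable_bool_set (d : measure_display) (T : measurableType d) (g : T -> bool) :
  measurable_fun setT g -> measurable [set w | g w].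
Proof.
move=> mg; have := mg measurableT [set true] I; rewrite setTI.
by congr measurable; apply/seteqP; split.
Qed.

Lemma union_bound (d : measure_display) (T : measurableType d) (R : realType)
  (P : probability T R) (I : eqType) (s : seq I) (F : I -> set T) (c : R) :
  (forall i, measurable (F i)) -> (forall i, i \in s -> (P (F i) <= c%:E)%E) ->
  (P (\big[setU/set0]_(i <- s) F i) <= ((size s)%:R * c)%:E)%E.
Proof.
move=> mF; elim: s => [|i s IH] Fc; first by rewrite big_nil measure0 mul0r.
rewrite big_cons /= mulrSr mulrDl mul1r addrC EFinD.
apply: le_trans (measureU2 _ _ _) _; [exact: mF|exact: bigsetU_measurable|].
apply: leeD; first by apply: Fc; rewrite mem_head.
by apply: IH => j js; apply: Fc; rewrite inE js orbT.
Qed.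

Section tails.
Context (d : measure_display) (T : measurableType d) (R : realType).
Variables (P : probability T R) (sigma : int -> T -> R).
Hypothesis iid : iid_family P sigma.
Hypothesis sigma0 : forall z w, 0 < sigma z w.

Definition tail (x : R) : R := fine (P [set w | x < sigma 0 w]).

Lemma iid_measurable z : measurable_fun setT (sigma z).
Proof. by have [] := iid. Qed.

Lemma gt_set_preimage z (x : R) : [set w | x < sigma z w] = sigma z @^-1` `]x, +oo[.
Proof. by apply/seteqP; split => w /=; rewrite in_itv /= andbT. Qed.

Lemma gt_set_measurable z (x : R) : measurable [set w | x < sigma z w].
Proof.
apply: measurable_bool_set; apply: measurable_fun_ltr => //; exact: iid_measurable.
Qed.

Lemma tailE z (x : R) : P [set w | x < sigma z w] = (tail x)%:E.
Proof.
rewrite /tail fineK; last exact: fin_num_measure (gt_set_measurable 0 x).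
by have [_ [Hid _]] := iid; rewrite !gt_set_preimage; exact: Hid.
Qed.

Lemma tail_ge0 x : 0 <= tail x.
Proof. by rewrite /tail fine_ge0. Qed.

Lemma tail_le1 x : tail x <= 1.
Proof. by rewrite -lee_fin -(tailE 0); apply: probability_le1; exact: gt_set_measurable. Qed.

Lemma tail_nincr (x y : R) : x <= y -> tail y <= tail x.
Proof.
move=> xy; rewrite -lee_fin -!(tailE 0); apply: le_measure; rewrite ?inE; try exact: gt_set_measurable.
by move=> w /= /(le_lt_trans xy).
Qed.

Lemma le_set_prob z (x : R) : P (sigma z @^-1` [set r | r <= x]) = (1 - tail x)%:E.
Proof.
rewrite EFinB -(tailE z) -probability_setC; last exact: gt_set_measurable.
congr (P _); apply/seteqP; split => w /=; first by move=> h /(le_lt_trans h); rewrite ltxx.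
by move/negP; rewrite -leNgt.
Qed.

Lemma between_set_prob z (x y : R) : x <= y ->
  P [set w | x < sigma z w <= y] = (tail x - tail y)%:E.
Proof.
move=> xy; have mA : measurable [set w | x < sigma z w <= y].
  apply: measurable_bool_set; apply: measurable_and.
    by apply: measurable_fun_ltr => //; exact: iid_measurable.
  by apply: measurable_fun_ler => //; exact: iid_measurable.
have disj : [set w | x < sigma z w <= y] `&` [set w | y < sigma z w] = set0.
  by apply/seteqP; split => w //= -[/andP[_ h]] /(le_lt_trans h); rewrite ltxx.
have U : [set w | x < sigma z w <= y] `|` [set w | y < sigma z w] = [set w | x < sigma z w].
  apply/seteqP; split => w /=.
    by case=> [/andP[]//|]; exact: le_lt_trans.
  by move=> ->; case: leP => /= ?; [left|right].
have : P [set w | x < sigma z w] = (P [set w | (x < sigma z w <= y)%R] + P [set w | (y < sigma z w)%R])%E.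
  by rewrite -U; apply: measureU => //; exact: gt_set_measurable.
by rewrite !tailE EFinB => ->; rewrite addeK.
Qed.

Lemma tail_cvg0 (e : R) : 0 < e -> exists x0 : R, forall x, x0 <= x -> tail x < e.
Proof.
move=> e0.
pose X : {mfun T >-> R} := HB.pack (sigma 0) (isMeasurableFun.Build _ _ _ _ _ (iid_measurable 0)).
have := @cvg_ccdfy0 _ _ _ P X.
move=> /fine_cvgP[_] /cvgrPdist_lt /(_ e e0) [x0 [_ Hx0]].
exists (x0 + 1) => x xx.
have := Hx0 x; rewrite /ccdf /= /distribution /pushforward -(gt_set_preimage 0) -/(tail x).
rewrite sub0r normrN ger0_norm ?tail_ge0 //; apply.
by apply: lt_le_trans xx; rewrite ltrDl.
Qed.

Hypothesis sv : slowly_varying (fun x : R => (tail x)^-1).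

(** If the tail vanished somewhere it would vanish from there on, and the ratio for [v = 1] would be
    [0] by the convention for inverses, which contradicts its limit [1]. *)
Lemma tail_gt0 x : 0 < tail x.
Proof.
rewrite lt0r tail_ge0 andbT; apply/negP => /eqP qx.
have := sv (@ltr01 R) => /cvgrPdist_lt /(_ 1 ltr01) [u0 [_ Hu]].
pose u := Num.max x (u0 + 1).
have : tail u = 0.
  by apply/eqP; rewrite eq_le tail_ge0 andbT -qx; apply: tail_nincr; rewrite le_max lexx.
have := Hu u; rewrite mulr1 => /[swap] ->.
rewrite invr0 mul0r subr0 normr1 ltxx => H; suff : false by [].
by apply: H; rewrite lt_max ltrDl ltr01 orbT.
Qed.

Lemma tail_sv (v th : R) : 0 < v -> 0 < th ->
  exists2 x0 : R, 0 < x0 & forall x, x0 <= x -> tail x <= (1 + th) * tail (v * x).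
Proof.
move=> v0 th0; have := sv v0 => /cvgrPdist_lt /(_ th th0) [u0 [_ Hu]].
exists (Num.max 1 (u0 + 1)); first by rewrite lt_max ltr01.
move=> x; rewrite ge_max => /andP[_ ux].
have /Hu : u0 < x by apply: lt_le_trans ux; rewrite ltrDl.
rewrite invrK [x * v]mulrC ltr_norml => /andP[+ _].
move=> H; have : tail x / tail (v * x) < 1 + th by rewrite mulrC; lra.
by move=> H2; apply: ltW; rewrite -ltr_pdivrMr //; exact: tail_gt0.
Qed.

End tails.

Lemma prob_setU_le (d : measure_display) (T : measurableType d) (R : realType)
  (P : probability T R) (A B : set T) (a b : R) :
  measurable A -> measurable B -> (P A <= a%:E)%E -> (P B <= b%:E)%E ->
  (P (A `|` B) <= (a + b)%:E)%E.
Proof.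
move=> mA mB Pa Pb; apply: le_trans (measureU2 _ mA mB) _.
by rewrite EFinD; exact: leeD.
Qed.

(** Bounds [(1 - x) ^+ n] by [1 / (n * x)], for the probability that [n] sites are all shallow. The
    induction rests on [(1 - x) * (1 + (n + 1) * x) <= 1 + n * x]. *)
Lemma bernoulli_exp (R : realType) (x : R) (n : nat) : 0 <= x <= 1 ->
  (1 - x) ^+ n * (1 + n%:R * x) <= 1.
Proof.
move=> /andP[x0 x1]; elim: n => [|n IH]; first by rewrite expr0 mul0r addr0 mulr1.
apply: le_trans IH; rewrite exprSr -mulrA ler_wpM2l ?exprn_ge0 ?subr_ge0 //.
have : 0 <= n%:R :> R by []. by rewrite -natr1; nra.
Qed.

(** * Probability of the bad environments at a fixed level *)

Section bad_events.
Context (d : measure_display) (T : measurableType d) (R : realType).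
Variables (P : probability T R) (sigma : int -> T -> R).
Hypothesis iid : iid_family P sigma.
Hypothesis sigma0 : forall z w, 0 < sigma z w.

Let q := tail P sigma.
Let ms z : measurable_fun setT (sigma z) := iid_measurable iid z.

Definition shallow_mean (z : int) (l : R) : R :=
  fine (\int[P]_w (shallow l (sigma z w))%:E).

Lemma shallow_measurable z (l : R) : measurable_fun setT (fun w => shallow l (sigma z w)).
Proof.
apply: measurable_fun_ifT => //; apply: measurable_fun_ler => //; exact: ms.
Qed.

Lemma shallow_ge0 z (l : R) w : 0 <= shallow l (sigma z w).
Proof. by rewrite /shallow; case: ifP => // _; exact: ltW. Qed.

Lemma shallow_integral z (l : R) : 0 < l ->
  (\int[P]_w (shallow l (sigma z w))%:E)%E = (shallow_mean z l)%:E /\ shallow_mean z l <= l.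
Proof.
move=> l0; have B : (\int[P]_w (shallow l (sigma z w))%:E <= l%:E)%E.
  apply: (@le_trans _ _ (\int[P]_w l%:E)%E).
    apply: ge0_le_integral => //.
    - by move=> w _; rewrite lee_fin shallow_ge0.
    - by apply/measurable_EFinP; exact: shallow_measurable.
    - by move=> w _; rewrite lee_fin /shallow; case: ifP => // _; exact: ltW.
  by rewrite integral_cst //= probability_setT mule1.
have fin : (\int[P]_w (shallow l (sigma z w))%:E)%E \is a fin_num.
  rewrite ge0_fin_numE; first exact: le_lt_trans (ltry l).
  by apply: integral_ge0 => w _; rewrite lee_fin shallow_ge0.
by rewrite -lee_fin /shallow_mean fineK.
Qed.

(** The two truncations differ only when the depth lies between [l] and [2 * l], by at most [2 * l].
    This is the recursion that [karamata_truncated] requires of [V]. *)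
Lemma shallow_mean_double z (l : R) : 0 < l ->
  shallow_mean z (2 * l) <= shallow_mean z l + 2 * l * (q l - q (2 * l)).
Proof.
move=> l0; have l20 : 0 < 2 * l by rewrite mulr_gt0.
have [E1 _] := shallow_integral z l0; have [E2 _] := shallow_integral z l20.
rewrite -lee_fin EFinD -E1 -E2.
pose A := [set w | l < sigma z w <= 2 * l].
have mA : measurable A.
  apply: measurable_bool_set; apply: measurable_and.
    by apply: measurable_fun_ltr => //; exact: ms.
  by apply: measurable_fun_ler => //; exact: ms.
have l2l : l <= 2 * l by lra.
have -> : (2 * l * (q l - q (2 * l)))%:E = (\int[P]_w ((2 * l)%:E * (\1_A w)%:E))%E.
  rewrite ge0_integralZl_EFin //; last by rewrite ltW.
  by rewrite integral_indic //= setIT /A (between_set_prob iid) // EFinM.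
  by apply/measurable_EFinP.
rewrite -ge0_integralD //.
- apply: ge0_le_integral => //.
  + by move=> w _; rewrite lee_fin shallow_ge0.
  + by apply/measurable_EFinP; exact: shallow_measurable.
  + apply: emeasurable_funD; apply/measurable_EFinP; first exact: shallow_measurable.
    by apply: measurable_funM.
  move=> w _; rewrite -EFinM -EFinD lee_fin /shallow indicE.
  have [wA|wA] := boolP (w \in A).
    rewrite mulr1; move: wA; rewrite inE /A /= => /andP[h1 h2].
    by rewrite h2 (lt_geF h1) add0r.
  rewrite mulr0 addr0; case: (leP (sigma z w) l) => h.
    by rewrite (le_trans h).
  case: (leP (sigma z w) (2 * l)) => // h2; move: wA; rewrite notin_setE => -[]; rewrite /A /=.
  by rewrite h h2.
- by move=> w _; rewrite lee_fin shallow_ge0.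
- by apply/measurable_EFinP; exact: shallow_measurable.
- by move=> w _; rewrite -EFinM lee_fin mulr_ge0 // ltW.
- by apply/measurable_EFinP; apply: measurable_funM.
Qed.

Lemma all_shallow_prob (s : seq int) (l : R) : uniq s ->
  P (\bigcap_(z in [set` s]) (sigma z @^-1` [set r | r <= l])) = ((1 - q l) ^+ size s)%:E.
Proof.
move=> us; have [_ [_ Hind]] := iid.
rewrite Hind //; last first.
  by move=> z; rewrite (_ : [set r | _] = `]-oo, l]%classic) //; apply/seteqP; split => r; rewrite /= in_itv.
elim: s {us} => [|z s IH]; first by rewrite big_nil.
by rewrite big_cons IH (le_set_prob iid) -EFinM exprS.
Qed.

Lemma two_deep_prob (z : int) (k : nat) (l : R) : (0 < k)%N ->
  P [set w | (l < sigma z w) && (l < sigma (z + k%:Z) w)] = (q l * q l)%:E.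
Proof.
move=> k0; have [_ [_ Hind]] := iid.
have us : uniq [:: z; z + k%:Z] by rewrite /= inE andbT; lia.
have := Hind _ (fun _ => `]l, +oo[%classic) us (fun _ => measurable_itv _).
rewrite !big_cons big_nil mule1 -!gt_set_preimage !(tailE iid) -EFinM => <-.
congr (P _); rewrite bigcap_seq !big_cons big_nil setIT -!gt_set_preimage.
by apply/seteqP; split => w /= => [/andP[]|[-> ->]].
Qed.

(** Markov's inequality, with the mean of the sum computed by linearity. *)
Lemma shallow_sum_prob (l delta rho : R) (s : seq int) : 0 < l -> 0 < delta ->
  (forall z, shallow_mean z l <= rho * l * q l) ->
  (P [set w | (delta * l < \sum_(z <- s) shallow l (sigma z w))%R] <=
   ((size s)%:R * (rho * q l / delta))%:E)%E.
Proof.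
move=> l0 delta0 Hm; set B := [set w | _].
have mS : measurable_fun setT (fun w => \sum_(z <- s) shallow l (sigma z w)).
  by apply: measurable_sum => z; exact: shallow_measurable.
have S0 w : 0 <= \sum_(z <- s) shallow l (sigma z w).
  by apply: sumr_ge0 => z _; exact: shallow_ge0.
have mB : measurable B.
  by apply: measurable_bool_set; apply: measurable_fun_ltr.
have dl0 : 0 < delta * l by rewrite mulr_gt0.
have : ((delta * l)%:E * P B <= \int[P]_w (\sum_(z <- s) shallow l (sigma z w))%:E)%E.
  rewrite -integral_cst //.
  apply: (@le_trans _ _ (\int[P]_(w in B) (\sum_(z <- s) shallow l (sigma z w))%:E)%E).
    apply: ge0_le_integral => //.
    - by move=> w _; rewrite lee_fin ltW.
    - by apply/measurable_EFinP; apply: measurable_funTS.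
    - by move=> w /= /ltW; rewrite lee_fin.
  apply: ge0_subset_integral => //.
    by apply/measurable_EFinP.
  by move=> w _; rewrite lee_fin.
have -> : (\int[P]_w (\sum_(z <- s) shallow l (sigma z w))%:E =
   (\sum_(z <- s) shallow_mean z l)%:E)%E.
  under eq_integral => w _ do rewrite -sumEFin.
  rewrite ge0_integral_sum //.
  - rewrite -sumEFin; apply: eq_bigr => z _.
    by have [] := shallow_integral z l0.
  - by move=> z; apply/measurable_EFinP; exact: shallow_measurable.
  - by move=> z w _; rewrite lee_fin shallow_ge0.
have fB : P B \is a fin_num by exact: fin_num_measure.
rewrite -(fineK fB) -EFinM !lee_fin => H.
have HS : \sum_(z <- s) shallow_mean z l <= (size s)%:R * (rho * l * q l).
  elim: (s) => [|z s' IH]; first by rewrite big_nil mul0r.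
  rewrite big_cons /= mulrSr mulrDl mul1r addrC; exact: lerD.
rewrite -(ler_pM2l dl0); apply: le_trans H (le_trans HS _).
rewrite le_eqVlt; apply/orP; left; apply/eqP; field.
by rewrite gt_eqF.
Qed.

(** The five terms of the bound match the five properties in order: a deep site near the origin, no
    deep site on one side, a site of intermediate depth, a large shallow mass, two deep sites close
    together. *)
Lemma bad_environment (l delta K rho rho' : R) (m H : nat) :
  0 < l -> 0 < delta -> 1 <= K -> (0 < H)%N -> 0 < q l ->
  (forall z, shallow_mean z l <= rho * l * q l) -> q l - q (K * l) <= rho' * q l ->
  exists Bad : set T, [/\ measurable Bad,
    (P Bad <= ((2 * m).+1%:R * q l + 2 / (H%:R * q l) + (2 * (2 * H)).+1%:R * (rho' * q l)
      + (2 * (2 * H)).+1%:R * (rho * q l / delta)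
      + ((2 * (2 * H)).+1 * m)%:R * (q l * q l))%:E)%E &
    forall w, ~ Bad w ->
    [/\ forall z, (`|z| <= m)%N -> sigma z w <= l,
        (exists2 k, (0 < k <= H)%N & l < sigma k%:Z w) /\
        (exists2 k, (0 < k <= H)%N & l < sigma (- k%:Z) w),
        forall z, (`|z| <= 2 * H)%N -> l < sigma z w -> K * l < sigma z w,
        \sum_(z <- window (2 * H)) shallow l (sigma z w) <= delta * l &
        forall z k, (`|z| <= 2 * H)%N -> (0 < k <= m)%N -> l < sigma z w ->
          sigma (z + k%:Z) w <= l]].
Proof.
move=> l0 delta0 K1 H0 q0 Hm HK.
have mgt z x : measurable [set w | (x < sigma z w)%R] by exact: (gt_set_measurable iid z x).
pose B1 := \big[setU/set0]_(z <- window m) [set w | (l < sigma z w)%R].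
(* All of [g 1] to [g H] are shallow. It is used for the positive and for the negative half line. *)
pose C (g : nat -> int) := \bigcap_(z in [set` [seq g k | k <- iota 1 H]])
  (sigma z @^-1` [set r | r <= l]).
pose B3 := \big[setU/set0]_(z <- window (2 * H)) [set w | (l < sigma z w <= K * l)%R].
pose B4 := [set w | (delta * l < \sum_(z <- window (2 * H)) shallow l (sigma z w))%R].
pose B5 := \big[setU/set0]_(p <- [seq (z, k) | z <- window (2 * H), k <- iota 1 m])
  [set w | ((l < sigma p.1 w) && (l < sigma (p.1 + p.2%:Z) w))%R].
have mbtw z : measurable [set w | (l < sigma z w <= K * l)%R].
  apply: measurable_bool_set; apply: measurable_and.
    by apply: measurable_fun_ltr => //; exact: ms.
  by apply: measurable_fun_ler => //; exact: ms.
have mpair (p : int * nat) :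
    measurable [set w | ((l < sigma p.1 w) && (l < sigma (p.1 + p.2%:Z) w))%R].
  by apply: measurable_bool_set; apply: measurable_and; apply: measurable_fun_ltr.
have mB1 : measurable B1 by exact: bigsetU_measurable.
have mB3 : measurable B3 by exact: bigsetU_measurable.
have mB5 : measurable B5 by exact: bigsetU_measurable.
have mB4 : measurable B4.
  apply: measurable_bool_set; apply: measurable_fun_ltr => //.
  by apply: measurable_sum => z; exact: shallow_measurable.
have mC g : measurable (C g).
  rewrite /C bigcap_seq; apply: bigsetI_measurable => z _.
  rewrite (_ : _ @^-1` _ = [set w | (sigma z w <= l)%R]) //.
  by apply: measurable_bool_set; apply: measurable_fun_ler => //; exact: ms.
have PC g : injective g -> (P (C g) <= (1 / (H%:R * q l))%:E)%E.
  move=> ginj; rewrite all_shallow_prob ?map_inj_uniq ?iota_uniq // lee_fin.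
  rewrite size_map size_iota ler_pdivlMr; last by rewrite mulr_gt0 // ltr0n.
  have := @bernoulli_exp R (q l) H.
  rewrite (ltW q0) (tail_le1 iid) => /(_ isT); apply: le_trans.
  by rewrite ler_wpM2l ?lerDr // exprn_ge0 // subr_ge0 (tail_le1 iid).
exists (B1 `|` (C (fun k => k%:Z) `|` C (fun k => - k%:Z)) `|` B3 `|` B4 `|` B5); split.
- by do 4 (apply: measurableU => //); exact: measurableU.
- apply: prob_setU_le => //; first by do 3 (apply: measurableU => //); exact: measurableU.
    apply: prob_setU_le => //; first by do 2 (apply: measurableU => //); exact: measurableU.
      apply: prob_setU_le => //; first by apply: measurableU => //; exact: measurableU.
        apply: prob_setU_le => //; first exact: measurableU.
          rewrite -size_window; apply: union_bound => // z _.
          by rewrite (tailE iid).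
        rewrite (_ : 2 / (H%:R * q l) = 1 / (H%:R * q l) + 1 / (H%:R * q l)); last by rewrite -mulrDl.
        by apply: prob_setU_le => //; apply: PC => i j; lia.
      rewrite -size_window; apply: union_bound => // z _.
      rewrite (between_set_prob iid) ?lee_fin //.
      by rewrite ler_peMl // ltW.
    by rewrite -size_window; exact: shallow_sum_prob.
  have <- : size [seq (z, k) | z <- window (2 * H), k <- iota 1 m] = ((2 * (2 * H)).+1 * m)%N.
    by rewrite size_allpairs size_window size_iota.
  apply: union_bound => //.
  move=> p /allpairsP[[z k] /= [_ + ->]] /=; rewrite mem_iota => /andP[k0 _].
  by rewrite two_deep_prob.
move=> w nB; split.
- move=> z zm; rewrite leNgt; apply/negP => lz; apply: nB; left; left; left; left.
  by rewrite /B1 -bigcup_seq; exists z => //=; rewrite mem_window.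
- split; apply: contrapT => nk; apply: nB; left; left; left; right; [left|right];
    move=> z /= /mapP[k + ->]; rewrite mem_iota => kH; rewrite leNgt; apply/negP => lk;
    by apply: nk; exists k => //; lia.
- move=> z zH lz; rewrite ltNge; apply/negP => zK; apply: nB; left; left; right.
  by rewrite /B3 -bigcup_seq; exists z => /=; [rewrite mem_window|rewrite lz zK].
- by rewrite leNgt; apply/negP => lS; apply: nB; left; right.
- move=> z k zH km lz; rewrite leNgt; apply/negP => lk; apply: nB; right.
  rewrite /B5 -bigcup_seq; exists (z, k); last by rewrite /= lz lk.
  by apply: (@allpairs_f _ _ _ (fun z k => (z, k))); rewrite ?mem_window ?mem_iota //; lia.
Qed.

End bad_events.

(** * Localization *)

Section measurability.
Context (d : measure_display) (T : measurableType d) (R : realType).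

Lemma measurable_cst_set (Q : Prop) : measurable [set w : T | Q].
Proof.
have [q|q] := pselect Q.
  by rewrite (_ : [set _ | _] = setT) //; apply/seteqP; split.
by rewrite (_ : [set _ | _] = set0) //; apply/seteqP; split.
Qed.

(** By uniqueness [xget] equals [z] exactly on [A z], except that the default value is also taken
    where all of the countably many [A y] fail. *)
Lemma measurable_xget (A : int -> set T) (x0 z : int) :
  (forall z, measurable (A z)) -> (forall w z z', A z w -> A z' w -> z = z') ->
  measurable [set w | xget x0 [set z | A z w] = z].
Proof.
move=> mA uA.
rewrite (_ : [set w | _] = A z `|` ([set w | z = x0] `&` ~` \bigcup_z A z)).
  apply: measurableU => //; apply: measurableI; first exact: measurable_cst_set.
  apply: measurableC; apply: countable_bigcupT_measurable => //.
apply/seteqP; split => w /=.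
  case: xgetP => [y _ Ay <-|NA <-]; [by left|right]; split => //.
  by move=> [y _ Ay]; exact: (NA y).
move=> [Az|[-> NA]].
  by apply: xget_unique => // y Ay; exact: uA Ay Az.
by apply: xgetPN => y Ay; apply: NA; exists y.
Qed.

Variable sigma : int -> T -> R.
Hypothesis ms : forall z, measurable_fun setT (sigma z).

Lemma measurable_first_exceedance (p : int -> bool) (r : int -> int -> bool) (l : R) (z : int) :
  measurable [set w | p z /\ l < sigma z w /\ forall y, r z y -> sigma y w <= l].
Proof.
rewrite (_ : [set w | _] = [set w | p z] `&` ([set w | l < sigma z w] `&`
    ~` \bigcup_y ([set w | r z y] `&` [set w | l < sigma y w]))).
  have mg y : measurable [set w | l < sigma y w].
    by apply: measurable_bool_set; apply: measurable_fun_ltr.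
  apply: measurableI; first exact: measurable_cst_set.
  apply: measurableI => //; apply: measurableC.
  apply: countable_bigcupT_measurable => // y.
  by apply: measurableI => //; exact: measurable_cst_set.
apply/seteqP; split => w /= [pz [lz H]]; do 2 (split => //).
  by move=> [y _ [/H + ly]]; rewrite leNgt ly.
by move=> y ry; rewrite leNgt; apply/negP => ly; apply: H; exists y.
Qed.

Lemma measurable_Z1 (l : R) (z : int) :
  measurable [set w | Z1 (fun z => sigma z w) l = z].
Proof.
pose A z := [set w | 0 < z /\ l < sigma z w /\ forall y : int, 0 < y -> y < z -> sigma y w <= l].
apply: (@measurable_xget A).
  move=> y; rewrite (_ : A y = [set w | (0 < y) /\ l < sigma y w /\
      forall x, (0 < x < y) -> sigma x w <= l]).
    exact: (@measurable_first_exceedance (fun z => 0 < z) (fun z x => 0 < x < z)).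
  apply/seteqP; split => w /= [y0 [ly H]]; do 2 (split => //).
    by move=> x /andP[]; exact: H.
  by move=> x x0 xy; apply: H; rewrite x0.
move=> w x y [x0 [lx Hx]] [y0 [ly Hy]]; have [xy|xy|//] := ltgtP x y.
  by have := Hy x x0 xy; rewrite leNgt lx.
by have := Hx y y0 xy; rewrite leNgt ly.
Qed.

Lemma measurable_Z2 (l : R) (z : int) :
  measurable [set w | Z2 (fun z => sigma z w) l = z].
Proof.
pose A z := [set w | z <= 0 /\ l < sigma z w /\ forall y : int, z < y -> y <= 0 -> sigma y w <= l].
apply: (@measurable_xget A).
  move=> y; rewrite (_ : A y = [set w | (y <= 0) /\ l < sigma y w /\
      forall x, (y < x <= 0) -> sigma x w <= l]).
    exact: (@measurable_first_exceedance (fun z => z <= 0) (fun z x => z < x <= 0)).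
  apply/seteqP; split => w /= [y0 [ly H]]; do 2 (split => //).
    by move=> x /andP[]; exact: H.
  by move=> x x0 xy; apply: H; rewrite x0.
move=> w x y [x0 [lx Hx]] [y0 [ly Hy]]; have [xy|xy|//] := ltgtP x y.
  by have := Hx y xy y0; rewrite leNgt ly.
by have := Hy x xy x0; rewrite leNgt lx.
Qed.

(** The pair of trap positions takes countably many values. Once it is frozen, only transition
    probabilities to fixed sites remain. *)
Lemma measurable_localization_event (sigma0 : forall z w, 0 < sigma z w) (l t eps : R) (i : bool) :
  let Z (i : bool) w :=
    if i then Z1 (fun z => sigma z w) l else Z2 (fun z => sigma z w) l in
  measurable [set w | eps < `| btm_prob (fun z => sigma z w) t (Z i w)
                        + `|Z i w|%:~R / (`|Z true w|%:~R + `|Z false w|%:~R) - 1 |].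
Proof.
move=> Z; pose f (p : int * int) w := btm_prob (fun z => sigma z w) t (if i then p.1 else p.2)
  + `|if i then p.1 else p.2|%:~R / (`|p.1|%:~R + `|p.2|%:~R) - 1.
rewrite (_ : [set w | _] = \bigcup_p ([set w | Z1 (fun z => sigma z w) l = p.1] `&`
    [set w | Z2 (fun z => sigma z w) l = p.2] `&` [set w | eps < `|f p w|])).
  apply: countable_bigcupT_measurable => // p.
  apply: measurableI; first by apply: measurableI; [exact: measurable_Z1|exact: measurable_Z2].
  apply: measurable_bool_set; apply: measurable_fun_ltr => //.
  apply: measurableT_comp => //; apply: measurable_funB => //.
  by apply: measurable_funD => //; exact: measurable_btm_prob.
apply/seteqP; split => w /=.
  move=> H; exists (Z true w, Z false w) => //; split => //.
by move=> [[z1 z2] _ /= [[E1 E2]]]; rewrite /f /Z /= E1 E2; case: (i).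
Qed.

End measurability.

(** * Choice of the constants and passage to the limit *)

Lemma expRN_le_inv (R : realType) (x : R) : 0 < x -> expR (- x) <= x^-1.
Proof.
move=> x0; rewrite expRN lef_pV2 ?posrE ?expR_gt0 //.
by apply: le_trans (expR_ge1Dx x); rewrite lerDr.
Qed.

(** Distances are measured in units of [1 / q l]: traps are sought up to [M / q l] and isolated up
    to [eta / q l]. The constants keep the bad probability below [zeta] and split the error into two
    halves of [eps]. *)
Lemma localization_estimate (d : measure_display) (T : measurableType d) (R : realType)
  (P : probability T R) (sigma : int -> T -> R) (eps zeta : R) :
  iid_family P sigma -> (forall z w, 0 < sigma z w) ->
  slowly_varying (fun x : R => (tail P sigma x)^-1) -> 0 < eps -> 0 < zeta ->
  exists l0 : R, forall l t : R, l0 <= l -> 0 < l ->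
    l * (tail P sigma l)^-1 / 4 <= t -> t <= 3 * (l * (tail P sigma l)^-1) ->
    exists Bad : set T, [/\ measurable Bad, (P Bad <= zeta%:E)%E &
      forall w, ~ Bad w ->
      let Z (i : bool) := if i then Z1 (fun z => sigma z w) l else Z2 (fun z => sigma z w) l in
      forall i, `| btm_prob (fun z => sigma z w) t (Z i)
         + `|Z i|%:~R / (`|Z true|%:~R + `|Z false|%:~R) - 1 | <= eps].
Proof.
move=> iid sigma0 sv eps0 zeta0.
(* Makes [2 / M] at most [zeta / 5]: the probability of finding no trap on one of the sides. *)
pose M := 10 / zeta + 1.
have M1 : 1 <= M by rewrite lerDr divr_ge0 // ltW.
have M0 : 0 < M by lra.
(* Bounds the size [4 * H + 1] of the window times [q l], because [H * q l <= M + 1]. *)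
pose c := 4 * M + 5.
have c0 : 0 < c by rewrite /c; lra.
(* The two probabilities involving [m] add up to at most [(3 + c) * eta], and [3 + c] is
   [4 * M + 8]. The cap [1] ensures [m <= H]. *)
pose eta := Num.min 1 (zeta / (5 * (4 * M + 8))).
have eta0 : 0 < eta by rewrite lt_min ltr01 divr_gt0 // mulr_gt0 //; lra.
have eta1 : eta <= 1 by rewrite ge_min lexx.
have etaz : eta * (4 * M + 8) <= zeta / 5.
  have : eta <= zeta / (5 * (4 * M + 8)) by rewrite ge_min lexx orbT.
  rewrite ler_pdivlMr; last by rewrite mulr_gt0 //; lra.
  by lra.
(* With [t >= l / (4 * q l)] this makes the exponent at least [4 / eps], hence twice the exponential
   at most [eps / 2]. *)
pose delta := eps / (64 * (M + 1)).
have delta0 : 0 < delta by rewrite divr_gt0 // mulr_gt0 //; lra.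
pose kappa := Num.min (eps / 2) 1.
have kappa0 : 0 < kappa by rewrite lt_min ltr01 divr_gt0.
have kappa1 : kappa <= 1 by rewrite ge_min lexx orbT.
have kappae : kappa <= eps / 2 by rewrite ge_min lexx.
(* From [t <= 3 * l / q l] and [m * q l >= eta / 2] one gets [t / m <= 6 / eta * l], the mass a trap
   must outweigh together with [2 * delta * l]. *)
pose K := Num.max 1 ((6 / eta + 2 * delta) / kappa).
have K1 : 1 <= K by rewrite le_max lexx.
have K0 : 0 < K by lra.
have Kk : 6 / eta + 2 * delta <= kappa * K.
  have : (6 / eta + 2 * delta) / kappa <= K by rewrite le_max lexx orbT.
  by rewrite [kappa * K]mulrC -ler_pdivrMr.
pose rho' := zeta / (5 * c).
pose rho := delta * rho'.
have rho'0 : 0 < rho' by rewrite divr_gt0 // mulr_gt0.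
have rho0 : 0 < rho by rewrite mulr_gt0.
have crho : c * rho' = zeta / 5 by rewrite /rho'; field; rewrite gt_eqF.
pose q := tail P sigma.
have q0 x : 0 < q x by exact: (tail_gt0 iid sv).
have q1 x : q x <= 1 by exact: (tail_le1 iid).
have [x1 Hx1] := tail_cvg0 iid (divr_gt0 eta0 (ltr0n R 2)).
have [x2 x20 Hx2] := tail_sv iid sv K0 rho'0.
have [x3 x30 Hx3] := @karamata_truncated R q q0 (tail_nincr iid)
  (fun th th0 => tail_sv iid sv (ltr0n R 2) th0) rho rho0.
exists (Num.max x1 (Num.max x2 x3)) => l t.
rewrite !ge_max => /andP[lx1 /andP[lx2 lx3]] l0 tlo thi.
have ql0 := q0 l; have ql1 := q1 l; rewrite -/q in tlo thi.
(* Rounding [eta / q l] down to [m] then costs at most half of [eta], and [m] is positive. *)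
have qeta : q l < eta / 2 := Hx1 l lx1.
have Hm z : shallow_mean P sigma z l <= rho * l * q l.
  apply: (Hx3 (shallow_mean P sigma z)) => // x x0.
    by have [] := shallow_integral iid sigma0 z x0.
  exact: (shallow_mean_double iid sigma0 z x0).
have HK : q l - q (K * l) <= rho' * q l.
  have := Hx2 l lx2; rewrite -/q => H.
  have : q (K * l) <= q l by apply: (tail_nincr iid); rewrite ler_peMl // ltW.
  move=> H2; have : rho' * q (K * l) <= rho' * q l by rewrite ler_pM2l.
  by lra.
pose H := (Num.truncn (M / q l)).+1.
pose m := Num.truncn (eta / q l).
have Mq0 : 0 <= M / q l by rewrite divr_ge0 // ltW.
have eq0 : 0 <= eta / q l by rewrite divr_ge0 // ltW.
have /andP[HMlo HMhi] := truncn_itv Mq0; have /andP[mlo mhi] := truncn_itv eq0.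
have HqM : M <= H%:R * q l by rewrite -ler_pdivrMr // ltW.
have HqM1 : H%:R * q l <= M + 1.
  rewrite /H -natr1 mulrDl mul1r; apply: lerD => //.
  by rewrite -ler_pdivlMr.
have mq : m%:R * q l <= eta by rewrite -ler_pdivlMr.
have mq2 : eta / 2 <= m%:R * q l.
  have : eta <= m.+1%:R * q l by rewrite -ler_pdivrMr // ltW.
  by rewrite -natr1 mulrDl mul1r; lra.
have m0 : (0 < m)%N.
  by rewrite lt0n; apply/negP => /eqP mE; rewrite mE mul0r in mq2; lra.
have mH : (m <= H)%N.
  rewrite -(ler_nat R) -(ler_pM2r ql0); lra.
have H0 : (0 < H)%N by [].
have H0' : 0 < H%:R :> R by rewrite ltr0n.
have m0' : 0 < m%:R :> R by rewrite ltr0n.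
have [Bad [mBad PBad GBad]] := @bad_environment d T R P sigma iid sigma0 l delta K rho rho' m H
  l0 delta0 K1 H0 ql0 Hm HK.
exists Bad; split => //.
  apply: (le_trans PBad); rewrite lee_fin -/q.
  have HQ : (2 * (2 * H)).+1%:R * q l <= c.
    by rewrite -natr1 !natrM /c; lra.
  have T1 : (2 * m).+1%:R * q l <= 3 * eta by rewrite -natr1 natrM; lra.
  have T2 : 2 / (H%:R * q l) <= zeta / 5.
    rewrite ler_pdivrMr; last by rewrite mulr_gt0.
    have : zeta * M = 10 + zeta by rewrite /M; field; rewrite gt_eqF.
    have : zeta * M <= zeta * (H%:R * q l) by rewrite ler_pM2l.
    by lra.
  have T3 : (2 * (2 * H)).+1%:R * (rho' * q l) <= zeta / 5.
    rewrite mulrCA -crho mulrC; apply: ler_wpM2r => //; exact: ltW.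
  have T4 : (2 * (2 * H)).+1%:R * (rho * q l / delta) <= zeta / 5.
    have -> : rho * q l / delta = rho' * q l by rewrite /rho; field; rewrite gt_eqF.
    exact: T3.
  have T5 : ((2 * (2 * H)).+1 * m)%:R * (q l * q l) <= c * eta.
    rewrite natrM mulrACA; apply: ler_pM => //; apply: mulr_ge0 => //; exact: ltW.
  have : 3 * eta + c * eta <= zeta / 5 by rewrite /c; lra.
  by lra.
move=> w /GBad[G1 [G2 G2'] G3 G4 G5] Z i.
have t0 : 0 < t.
  by apply: lt_le_trans tlo; rewrite !mulr_gt0 // invr_gt0.
have Hk : (t / m%:R + 2 * delta * l) / (K * l) <= kappa.
  rewrite ler_pdivrMr ?mulr_gt0 //.
  have : t / m%:R <= 6 / eta * l.
    rewrite ler_pdivrMr //; apply: (le_trans thi).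
    rewrite (_ : 3 * (l * (q l)^-1) = (3 * l) / q l); last by rewrite mulrA.
    rewrite ler_pdivrMr // (_ : 6 / eta * l * m%:R * q l = (6 * l / eta) * (m%:R * q l)); last by ring.
    have -> : 3 * l = (6 * l / eta) * (eta / 2) by field; rewrite gt_eqF.
    by apply: ler_wpM2l => //; rewrite divr_ge0 ?mulr_ge0 // ltW.
  have : (6 / eta + 2 * delta) * l <= kappa * K * l by rewrite ler_pM2r.
  by lra.
have mH' : (0 < m <= H)%N by rewrite m0.
have := @good_environment R (fun z => sigma z w) l t delta K kappa m H (fun z => sigma0 z w)
  mH' l0 (ltW t0) delta0 K0 kappa1 Hk G1 G2 G2' G3 G4 G5 i.
rewrite -/Z => /le_trans; apply.
pose x := t / (4 * H%:R * delta * l).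
have x4 : 4 / eps <= x.
  rewrite /x ler_pdivlMr; last by do 3 (apply: mulr_gt0 => //).
  apply: le_trans tlo.
  have -> : 4 / eps * (4 * H%:R * delta * l) = l / (4 * (M + 1)) * H%:R.
    by rewrite /delta; field; rewrite !gt_eqF //; lra.
  rewrite -(ler_pM2r ql0).
  have -> : l * (q l)^-1 / 4 * q l = l / (4 * (M + 1)) * (M + 1).
    by field; rewrite !gt_eqF //; lra.
  rewrite -[l / _ * H%:R * q l]mulrA; apply: ler_wpM2l => //.
  by apply: divr_ge0; [exact: ltW|lra].
have x0 : 0 < x by apply: lt_le_trans x4; rewrite divr_gt0.
have : expR (- x) <= eps / 4.
  apply: le_trans (expRN_le_inv x0) _.
  have e4 : 0 < 4 / eps by rewrite divr_gt0.
  by rewrite -[eps / 4]invf_div lef_pV2 ?posrE.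
rewrite /x -mulNr => He.
by lra.
Qed.

Unset Implicit Arguments.

Theorem theorem1p2 (d : measure_display) (T : measurableType d) (R : realType)
  (P : probability T R) (sigma : int -> T -> R) :
  iid_family P sigma ->
  (forall z w, 0 < sigma z w) ->
  slowly_varying (fun x : R => (fine (P [set w | x < sigma 0 w]))^-1) ->
  let L := fun x : R => (fine (P [set w | x < sigma 0 w]))^-1 in
  let Zi := fun (i : bool) (t : R) (w : T) =>
    if i then Z1 (fun z => sigma z w) (ell L t) else Z2 (fun z => sigma z w) (ell L t) in
  forall i : bool, forall eps : R, 0 < eps ->
    P [set w | eps < `| btm_prob (fun z => sigma z w) t (Zi i t w)
                        + `|Zi i t w|%:~R / (`|Zi true t w|%:~R + `|Zi false t w|%:~R)
                        - 1 |] @[t --> +oo] --> 0%E.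
Proof.
move=> iid sigma0 sv L Zi i eps eps0.
(* The event must be measurable for its probability to be bounded by that of [Bad] through
   monotonicity. *)
have Bmeas t : measurable [set w | eps < `| btm_prob (fun z => sigma z w) t (Zi i t w)
    + `|Zi i t w|%:~R / (`|Zi true t w|%:~R + `|Zi false t w|%:~R) - 1 |].
  exact: (measurable_localization_event (iid_measurable iid) sigma0 (ell L t) t eps i).
apply/fine_cvgP; split.
  by apply: nearW => t; apply: fin_num_measure; exact: Bmeas.
apply/cvgrPdist_le => zeta zeta0.
have [l0 Hl0] := localization_estimate iid sigma0 sv eps0 zeta0.
have q0 := tail_gt0 iid sv.
have L1 x : 1 <= L x by rewrite invf_ge1 ?q0 // (tail_le1 iid).
have Lmono x y : x <= y -> L x <= L y.
  by move=> xy; rewrite lef_pV2 ?posrE ?q0 //; exact: (tail_nincr iid).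
have Ldouble : exists2 x0 : R, 0 < x0 & forall x, x0 <= x -> L (2 * x) <= 3 / 2 * L x.
  (* Slow variation with ratio [2] and tolerance [1 / 2] gives the factor [3 / 2] required by
     [ell_bounds]. *)
  have [x0 x00 Hx0] := tail_sv iid sv (ltr0n R 2) (divr_gt0 (ltr01 : 0 < 1 :> R) (ltr0n R 2)).
  exists x0 => // x /Hx0; rewrite /L => H.
  rewrite ler_pdivlMr ?q0 // mulrC ler_pdivrMr ?q0 //.
  by move: H; rewrite /tail; lra.
near=> t.
have [l0t lt0 tlo thi] : [/\ l0 <= ell L t, 0 < ell L t,
    ell L t * L (ell L t) / 4 <= t & t <= 3 * (ell L t * L (ell L t))].
  by near: t; exact: ell_bounds.
have [Bad [mBad PBad HBad]] := Hl0 (ell L t) t l0t lt0 tlo thi.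
rewrite sub0r normrN ger0_norm ?fine_ge0 //.
rewrite -lee_fin fineK; last by apply: fin_num_measure; exact: Bmeas.
apply: le_trans PBad; apply: le_measure; rewrite ?inE //.
move=> w /= Hw; apply: contrapT => nB.
by move: Hw; rewrite ltNge => /negP; apply; exact: HBad.
Unshelve. all: by end_near. Qed.
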